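(* Let $f,g_1,\dots,g_r,h_1,\dots,h_s\in\mathbb R[\mathbf X]$, $S=\mathcal S(\mathbf g,\pm\mathbf h)$, and assume the minimum $f^*$ of $f$ on $S$ is attained. Let $J$ be the polar ideal and $\mathbf h'\subset\mathbb R[\mathbf X]$ a finite set of generators of $J$. If $\mathcal V_{\mathbb R}(J)$ is finite, then the moment relaxation $(\mathcal L_{2d}(\mathbf g,\pm\mathbf h'))_{d\in\mathbb N}$ is exact for $f$: $f^*_{\mathrm{MoM},d}=f^*$ for all large $d$, and for every large $k$ there exists $d(k)$ such that for $d\ge d(k)$, every $\sigma\in\mathcal L^{(1)}_{2d}(\mathbf g,\pm\mathbf h')$ with $\sigma(f)=f^*$ satisfies $\sigma^{[k]}\in\mathcal M^{(1)}(S\cap\mathcal V_{\mathbb R}(J))^{[k]}\subseteq \mathcal M^{(1)}(S)^{[k]}$.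
   Context: $\mathbb R[\mathbf X]=\mathbb R[X_1,\dots,X_n]$, $\mathbb R[\mathbf X]_t$ polynomials of degree $\le t$, $\Sigma^2$ sums of squares, $\Sigma^2_t=\Sigma^2\cap\mathbb R[\mathbf X]_t$. For a finite family $G$, $\mathcal Q_t(G)=\{s_0+\sum_{g\in G}s_gg:s_0\in\Sigma^2_t,s_g\in\Sigma^2,\deg s_g\le t-\deg g\}$, $\mathcal L_t(G)=\{\sigma\in(\mathbb R[\mathbf X]_t)^*:\sigma\ge0\text{ on }\mathcal Q_t(G)\}$, $\mathcal L^{(1)}_t(G)$ those with $\sigma(1)=1$. $(\mathbf g,\pm\mathbf h)$ denotes the family $g_1,\dots,g_r,h_1,-h_1,\dots,h_s,-h_s$; $\mathcal S(G)=\{x\in\mathbb R^n: g(x)\ge0\ \forall g\in G\}$. $f^*_{\mathrm{MoM},d}=\inf\{\sigma(f):\sigma\in\mathcal L^{(1)}_{2d}(\mathbf g,\pm\mathbf h')\}$. $\mathcal V_{\mathbb R}(J)$ is the set of real common zeros of $J$. $\sigma^{[k]}$ restriction to $\mathbb R[\mathbf X]_k$, $B^{[k]}=\{\sigma^{[k]}:\sigma\in B\}$, $\mathcal M^{(1)}(T)$ Borel probability measures supported in $T$ viewed as functionals $f\mapsto\int f d\mu$. Polar ideal: $J=(h_1,\dots,h_s)+\prod_{\{a_1,\dots,a_k\}\subseteq\{1,\dots,r\}}\Big((g_{a_1},\dots,g_{a_k})+M_{s+k+1}\big(\operatorname{Jac}(f,h_1,\dots,h_s,g_{a_1},\dots,g_{a_k})\big)\Big)$,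 the product running over all subsets (including the empty one), where $\operatorname{Jac}(\cdot)$ is the $(s+k+1)\times n$ Jacobian matrix of the listed polynomials and $M_l(\cdot)$ is the ideal generated by its $l\times l$ minors (the zero ideal if $l>n$). *)

(* Defs.v *)
From HB Require Import structures.
From mathcomp Require Import all_boot all_order all_algebra.
From mathcomp.multinomials Require Export mpoly.
From mathcomp Require Export all_classical all_reals all_analysis.
Export Order.TTheory GRing.Theory Num.Theory.
Export numFieldNormedType.Exports.

Set Implicit Arguments.
Unset Strict Implicit.
Unset Printing Implicit Defensive.

Local Open Scope ring_scope.
Local Open Scope classical_set_scope.

Section PolyOpt.
Variables (R : realType) (n : nat).
Local Notation P := {mpoly R[n]}.

(** deg p <= t   (msize p = 1 + total degree, msize 0 = 0, so deg 0 = -oo) *)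
Definition deg_le (p : P) (t : nat) : Prop := (msize p <= t.+1)%N.

Definition sos (p : P) : Prop := exists s : seq P, p = \sum_(q <- s) q ^+ 2.

(** deg s <= t - deg g, with the convention deg 0 = -oo *)
Definition deg_le_sub (s g : P) (t : nat) : Prop :=
  s = 0 \/ g = 0 \/ (msize s + msize g <= t.+2)%N.

Definition quadmod (G : seq P) (t : nat) (p : P) : Prop :=
  exists (s0 : P) (s : 'I_(size G) -> P),
    [/\ sos s0, deg_le s0 t,
        (forall i, sos (s i) /\ deg_le_sub (s i) G`_i t) &
        p = s0 + \sum_(i < size G) s i * G`_i].

(** an element of (R[X]_t)^* : a map which is linear on R[X]_t
    (its values outside R[X]_t are irrelevant) *)
Definition functional_on (t : nat) (L : P -> R) : Prop :=
  forall (a : R) (p q : P), deg_le p t -> deg_le q t ->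
    L (a *: p + q) = a * L p + L q.

Definition Lcone (G : seq P) (t : nat) (L : P -> R) : Prop :=
  functional_on t L /\ (forall p, quadmod G t p -> 0 <= L p).
Definition Lcone1 (G : seq P) (t : nat) (L : P -> R) : Prop :=
  Lcone G t L /\ L 1 = 1.

Definition pm_family (g h : seq P) : seq P :=
  g ++ flatten [seq [:: q; - q] | q <- h].

Definition peval (p : P) (x : 'rV[R]_n) : R := p.@[fun i => x ord0 i].

Definition semialg (G : seq P) : set 'rV[R]_n :=
  [set x | forall g, g \in G -> 0 <= peval g x].

Definition fMoM (f : P) (G : seq P) (d : nat) : \bar R :=
  ereal_inf [set (L f)%:E | L in Lcone1 G (2 * d)].

Definition ideal_gen (A : set P) : set P :=
  [set p | exists (m : nat) (c q : 'I_m -> P),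
     (forall i, A (q i)) /\ p = \sum_(i < m) c i * q i].
Definition idealD (I1 I2 : set P) : set P := ideal_gen (I1 `|` I2).
Definition idealM (I1 I2 : set P) : set P :=
  ideal_gen [set p | exists a b, [/\ I1 a, I2 b & p = a * b]].
Definition ideal_prod (Is : seq (set P)) : set P :=
  foldr idealM (ideal_gen [set 1]) Is.

Definition jacobian (L : seq P) : 'M[P]_(size L, n) :=
  \matrix_(i < size L, j < n) mderiv j L`_i.

(** ideal generated by the l x l minors of A (zero ideal if there are none) *)
Definition minor_ideal (l m : nat) (A : 'M[P]_(m, n)) : set P :=
  ideal_gen [set p | exists (r : 'I_l -> 'I_m) (c : 'I_l -> 'I_n),
     [/\ injective r, injective c & p = \det (mxsub r c A)]].

Definition polar_ideal (f : P) (g h : seq P) : set P :=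
  idealD (ideal_gen [set q | q \in h])
    (ideal_prod
       [seq idealD (ideal_gen [set q | exists2 a : 'I_(size g), a \in A & q = g`_a])
                   (minor_ideal (size h + #|A|).+1
                      (jacobian (f :: h ++ [seq g`_a | a : 'I_(size g) <- enum A])))
       | A : {set 'I_(size g)} <- enum [set: {set 'I_(size g)}]]).

Definition real_variety (J : set P) : set 'rV[R]_n :=
  [set x | forall p, J p -> peval p x = 0].

Definition borelRn := g_sigma_algebraType (open : set_system 'rV[R]_n).

Definition msupport (mu : probability borelRn R) : set 'rV[R]_n :=
  [set x | forall U : set 'rV[R]_n, open U -> U x -> (0 < mu U)%E].

Definition moment_restr (T : set 'rV[R]_n) (k : nat) (L : P -> R) : Prop :=
  exists mu : probability borelRn R,
    [/\ msupport mu `<=` T,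
        (forall p : P, mu.-integrable setT (fun x => (peval p x)%:E)) &
        (forall p : P, deg_le p k ->
           (\int[mu]_x (peval p x)%:E)%E = (L p)%:E)].

End PolyOpt.

(* Main.v *)
(** Everything rests on one fact: if [q] vanishes on the finite set V = V_R(J),
    then sigma(q) = 0 for every sigma in the cone of order [2 d], once [d] is
    large.  Indeed the real Nullstellensatz gives q^(2m) + s in J with s a sum
    of squares, so sigma(q^(2m)) <= 0, hence = 0, and Cauchy-Schwarz descends
    from q^(2^b) to q.  Applied to X^a - sum_v v^a e_v, to e_v - e_v^2 and to
    e_v^2 g - g(v) e_v, where the e_v are the Lagrange polynomials of V, this
    says that sigma is, in degree <= k, the atomic measure sum_v sigma(e_v) delta_v,
    with nonnegative weights that vanish off S.  A minimizer of f on S belongs to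
    V by the Fritz John conditions, obtained by a penalty argument, so the
    relaxation has value f*.

    For the real Nullstellensatz, an ideal maximal among those that miss the
    multiplicative set u^(2m) + (sums of squares) is a real prime ideal.  Its
    residue field is embedded in an algebraically closed field, in which a
    maximal cone of nonnegative elements yields a real closed field L with a
    zero of J where u <> 0; this zero is transferred to R by quantifier
    elimination.  Algebraic closures are only available for countable fields,
    so one first replaces the real coefficients by extra variables over the
    rationals; and the elimination procedure must be shown not to depend on the
    real closed field, which makes it usable for R and L at the same time. *)

Require Import Defs.
From HB Require Import structures.
From mathcomp Require Import all_boot all_order all_algebra all_field.
From mathcomp.multinomials Require Import mpoly.
From mathcomp Require Import generic_quotient ring_quotient.
From mathcomp Require qe_rcf_th qe_rcf.
From mathcomp Require Import all_classical all_reals all_analysis.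
From mathcomp Require Import measurable_realfun ring lra zify.
Import Order.TTheory GRing.Theory Num.Theory.
Set Implicit Arguments.
Unset Strict Implicit.
Unset Printing Implicit Defensive.
Local Open Scope ring_scope.
Local Open Scope classical_set_scope.

(** * Uniform quantifier elimination *)

Section Naturality.
Import qe_rcf.
Variables (F0 F : realFieldType) (phi : {rmorphism F0 -> F}).
Local Notation term := qe_rcf.term.
Local Notation formula := qe_rcf.formula.

Fixpoint tmap (t : term F0) : term F :=
  match t with
  | Var i => Var F i
  | Const c => Const (phi c)
  | NatConst m => NatConst F m
  | Add a b => Add (tmap a) (tmap b)
  | Opp a => Opp (tmap a)
  | NatMul a m => NatMul (tmap a) m
  | Mul a b => Mul (tmap a) (tmap b)
  | Exp a m => Exp (tmap a) m
  end.

Fixpoint fmap (f : formula F0) : formula F :=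
  match f with
  | Bool b => Bool b
  | Equal a b => Equal (tmap a) (tmap b)
  | Lt a b => Lt (tmap a) (tmap b)
  | Le a b => Le (tmap a) (tmap b)
  | And a b => And (fmap a) (fmap b)
  | Or a b => Or (fmap a) (fmap b)
  | Implies a b => Implies (fmap a) (fmap b)
  | Not a => Not (fmap a)
  end.

Local Notation pmap := (map tmap).

(* The elimination procedure is written in continuation-passing style over a
   fixed field of constants: [c] over [F0] and [c'] over [F] compute the same
   value, up to [m], and branch in the same way. *)
Definition natural_cps T T' (m : T -> T') (c : (T -> formula F0) -> formula F0)
    (c' : (T' -> formula F) -> formula F) :=
  forall k k', (forall x, fmap (k x) = k' (m x)) -> fmap (c k) = c' k'.

Lemma natural_Size p : natural_cps id (Size p) (Size (pmap p)).
Proof.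
elim: p => [|a p IH] k k' h /=; first exact: h.
by rewrite /bind_def; apply: IH => -[|m] //=; rewrite !h.
Qed.

Lemma natural_Isnull p : natural_cps id (Isnull p) (Isnull (pmap p)).
Proof. by move=> k k' h; apply: natural_Size => n; apply: h. Qed.

Lemma natural_LtSize p q : natural_cps id (LtSize p q) (LtSize (pmap p) (pmap q)).
Proof.
by move=> k k' h; apply: natural_Size => n; apply: natural_Size => m; apply: h.
Qed.

Lemma natural_LeadCoef p : natural_cps tmap (LeadCoef p) (LeadCoef (pmap p)).
Proof.
elim: p => [|a p IH] k k' h /=; first by rewrite h /= rmorph0.
by rewrite /bind_def; apply: IH => l /=; rewrite !h.
Qed.

Lemma natural_AmulXn a n : pmap (AmulXn a n) = AmulXn (tmap a) n.
Proof. by elim: n => //= n ->; rewrite rmorph0. Qed.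

Lemma natural_AddPoly p q : pmap (AddPoly p q) = AddPoly (pmap p) (pmap q).
Proof. by elim: p q => //= a p IH [|b q] //=; rewrite IH. Qed.

Lemma natural_ScalPoly c p : pmap (ScalPoly c p) = ScalPoly (tmap c) (pmap p).
Proof. by rewrite /ScalPoly -!map_comp. Qed.

Lemma natural_MulPoly p q : pmap (MulPoly p q) = MulPoly (pmap p) (pmap q).
Proof. by elim: p => //= a p IH; rewrite natural_AddPoly natural_ScalPoly /= IH. Qed.

Lemma natural_ExpPoly p n : pmap (ExpPoly p n) = ExpPoly (pmap p) n.
Proof.
rewrite /ExpPoly; case: n => //= n; elim: n => //= n IH.
by rewrite natural_MulPoly IH.
Qed.

Lemma natural_OppPoly p : pmap (OppPoly p) = OppPoly (pmap p).
Proof. by rewrite /OppPoly natural_ScalPoly /= rmorphN1. Qed.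

Lemma natural_NatMulPoly n p : pmap (NatMulPoly n p) = NatMulPoly n (pmap p).
Proof. by rewrite /NatMulPoly natural_ScalPoly. Qed.

Lemma natural_Deriv p : pmap (Deriv p) = Deriv (pmap p).
Proof. by elim: p => //= a p IH; rewrite natural_AddPoly /= IH. Qed.

Definition rmap (d : nat * polyF F0 * polyF F0) :=
  (d.1.1, pmap d.1.2, pmap d.2).

Lemma natural_Rediv_rec_loop q sq cq c qq r n :
  natural_cps rmap (Rediv_rec_loop q sq cq c qq r n)
    (Rediv_rec_loop (pmap q) sq (tmap cq) c (pmap qq) (pmap r) n).
Proof.
elim: n c qq r => [|n IH] c qq r k k' h /=; rewrite /bind_def;
  apply: natural_Size => sr; case: ifP => // _; rewrite ?h //;
  apply: natural_LeadCoef => lr.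
  rewrite h /rmap /= !natural_AddPoly natural_OppPoly !natural_MulPoly natural_AmulXn.
  by [].
have := IH c.+1 (AddPoly (MulPoly qq [:: cq]) (AmulXn lr (sr - sq)))
  (AddPoly (MulPoly r [:: cq]) (OppPoly (MulPoly (AmulXn lr (sr - sq)) q))) k k' h.
by rewrite !natural_AddPoly natural_OppPoly !natural_MulPoly natural_AmulXn.
Qed.

Lemma natural_Rediv p q : natural_cps rmap (Rediv p q) (Rediv (pmap p) (pmap q)).
Proof.
move=> k k' h; apply: natural_Isnull => -[]; first by rewrite h /rmap /= rmorph0.
apply: natural_Size => sq; apply: natural_Size => sp; apply: natural_LeadCoef => lq.
have := @natural_Rediv_rec_loop q sq lq 0 [:: Const 0] p sp k k' h.
by rewrite /= rmorph0.
Qed.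

Lemma natural_Rmod p q : natural_cps pmap (Rmod p q) (Rmod (pmap p) (pmap q)).
Proof. by move=> k k' h; apply: natural_Rediv => -[[? ?] ?] /=; apply: h. Qed.

Lemma natural_Rscal p q : natural_cps id (Rscal p q) (Rscal (pmap p) (pmap q)).
Proof. by move=> k k' h; apply: natural_Rediv => -[[? ?] ?] /=; apply: h. Qed.

Lemma natural_Rgcd_loop n p q :
  natural_cps pmap (Rgcd_loop n p q) (Rgcd_loop n (pmap p) (pmap q)).
Proof.
elim: n p q => [|n IH] p q k k' h; apply: natural_Rmod => r; apply: natural_Isnull;
  by move=> [] /=; rewrite ?h //; apply: IH.
Qed.

Lemma natural_Rgcd p q : natural_cps pmap (Rgcd p q) (Rgcd (pmap p) (pmap q)).
Proof.
move=> k k' h; apply: natural_LtSize => -[] /=; apply: natural_Isnull => -[] /=;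
  rewrite ?h //; apply: natural_Size => n; exact: natural_Rgcd_loop.
Qed.

Lemma natural_BigRgcd ps : natural_cps pmap (BigRgcd ps) (BigRgcd (map pmap ps)).
Proof.
elim: ps => [|p ps IH] k k' h /=; first by rewrite h /= rmorph0.
by apply: IH => r; apply: natural_Rgcd.
Qed.

Lemma natural_Changes s : natural_cps id (Changes s) (Changes (pmap s)).
Proof.
elim: s => [|a s IH] k k' h /=; first exact: h.
by apply: IH => v /=; rewrite !h; case: s.
Qed.

Lemma natural_SeqPInfty ps :
  natural_cps pmap (SeqPInfty ps) (SeqPInfty (map pmap ps)).
Proof.
elim: ps => [|p ps IH] k k' h /=; first exact: h.
by apply: natural_LeadCoef => lp; apply: IH => lps; apply: h.
Qed.

Lemma natural_SeqMInfty ps :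
  natural_cps pmap (SeqMInfty ps) (SeqMInfty (map pmap ps)).
Proof.
elim: ps => [|p ps IH] k k' h /=; first exact: h.
apply: natural_LeadCoef => lp; apply: natural_Size => sp; apply: IH => lps.
by rewrite h /= rmorphN1.
Qed.

Lemma natural_ChangesPoly ps : natural_cps id (ChangesPoly ps) (ChangesPoly (map pmap ps)).
Proof.
move=> k k' h; apply: natural_SeqMInfty => mps; apply: natural_SeqPInfty => pps.
by apply: natural_Changes => vm; apply: natural_Changes => vp; apply: h.
Qed.

Lemma natural_NextMod p q : natural_cps pmap (NextMod p q) (NextMod (pmap p) (pmap q)).
Proof.
move=> k k' h; apply: natural_LeadCoef => lq; apply: natural_Rscal => spq.
by apply: natural_Rmod => rpq; rewrite h natural_ScalPoly.
Qed.

Lemma natural_ModsAux p q n :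
  natural_cps (map pmap) (ModsAux p q n) (ModsAux (pmap p) (pmap q) n).
Proof.
elim: n p q => [|n IH] p q k k' h /=; first exact: h.
apply: natural_Isnull => -[]; first exact: h.
by apply: natural_NextMod => npq; apply: IH => ps; apply: h.
Qed.

Lemma natural_Mods p q : natural_cps (map pmap) (Mods p q) (Mods (pmap p) (pmap q)).
Proof.
by move=> k k' h; apply: natural_Size => sp; apply: natural_Size => sq; apply: natural_ModsAux.
Qed.

Lemma natural_TaqR p q : natural_cps id (TaqR p q) (TaqR (pmap p) (pmap q)).
Proof.
move=> k k' h; rewrite /TaqR /bind_def -natural_Deriv -natural_MulPoly.
by apply: natural_Mods => r; apply: natural_ChangesPoly.
Qed.

Lemma natural_nth ps i : pmap (nth [::] ps i) = nth [::] (map pmap ps) i.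
Proof. by elim: ps i => [|p ps IH] [|i] /=. Qed.

Lemma natural_PolyComb sq sc : pmap (PolyComb sq sc) = PolyComb (map pmap sq) sc.
Proof.
rewrite /PolyComb size_map; elim: (iota _ _) => //= i s IH.
by rewrite natural_MulPoly IH natural_ExpPoly natural_nth.
Qed.

Lemma natural_Pcq sq i : pmap (Pcq sq i) = Pcq (map pmap sq) i.
Proof.
rewrite /Pcq natural_nth -map_comp size_map.
by congr nth; apply: eq_map => sc /=; rewrite natural_PolyComb.
Qed.

Lemma natural_TaqsR p sq i : natural_cps tmap (TaqsR p sq i) (TaqsR (pmap p) (map pmap sq) i).
Proof.
move=> k k' h; rewrite /TaqsR /bind_def -natural_Pcq; apply: natural_TaqR => n.
by rewrite h /= rmorph_int.
Qed.

Lemma natural_BoundingPoly sq : pmap (BoundingPoly sq) = BoundingPoly (map pmap sq).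
Proof.
rewrite /BoundingPoly natural_Deriv; congr Deriv.
by elim: sq => //= p sq IH; rewrite natural_MulPoly IH.
Qed.

(** These numbers are entries of the inverse of a matrix with integer entries, and a field morphism
    fixes integers and commutes with matrix inversion. *)
Lemma natural_coefs n i : phi (qe_rcf_th.coefs F0 n i) = qe_rcf_th.coefs F n i.
Proof.
rewrite /qe_rcf_th.coefs.
have -> s j : phi (s`_j) = (map phi s)`_j.
  by elim: s j => [|a s IH] [|j] //=; rewrite rmorph0.
rewrite -map_comp; congr nth; apply: eq_map => j /=.
rewrite !castmxE /=.
set M0 := map_mx _ _; set M := map_mx _ _.
have -> : M = map_mx phi M0.
  by apply/matrixP => a b; rewrite !mxE rmorph_int.
by rewrite -map_invmx mxE.
Qed.

Lemma natural_Coefs n i : tmap (Coefs F0 n i) = Coefs F n i.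
Proof.
case: n => [|[|n]]; rewrite /Coefs /=.
- by rewrite rmorph_nat.
- by case: i => [|[|[|i]]] /=; rewrite ?fmorphV ?rmorph_nat ?nth_nil ?rmorph0.
- by rewrite natural_coefs.
Qed.

Lemma natural_CcountWeak p sq :
  natural_cps tmap (CcountWeak p sq) (CcountWeak (pmap p) (map pmap sq)).
Proof.
move=> k k' h; rewrite /CcountWeak size_map.
have -> : (NatConst F 0) = tmap (NatConst F0 0) by [].
elim: (3 ^ _)%N (NatConst F0 0) => [|i IH] s /=; first exact: h.
by apply: natural_TaqsR => x; rewrite -natural_Coefs; apply: (IH (Add (Mul x _) s)).
Qed.

(** With [F0 = rat], this allows the elimination to be run once over the rationals and its output to
    be read in any real closed field. *)
Lemma natural_CcountGt0 sp sq :
  fmap (CcountGt0 sp sq) = CcountGt0 (map pmap sp) (map pmap sq).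
Proof.
rewrite /CcountGt0; apply: natural_BigRgcd => p; apply: natural_Isnull => -[] /=.
  rewrite /bind_def -natural_BoundingPoly; apply: natural_CcountWeak => cw /=.
  congr (Or _ (Or _ _)); elim: sq => //= q sq ->; congr And.
  - by apply: natural_LeadCoef => l.
  - by apply: natural_Size => n; apply: natural_LeadCoef => l.
by apply: natural_CcountWeak => c.
Qed.

Lemma natural_abstrX i t : pmap (abstrX i t) = abstrX i (tmap t).
Proof.
elim: t => //=.
- by move=> n; case: ifP.
- by move=> s IHs t IHt; rewrite natural_AddPoly IHs IHt.
- by move=> s IHs; rewrite natural_OppPoly IHs.
- by move=> s IHs n; rewrite natural_NatMulPoly IHs.
- by move=> s IHs t IHt; rewrite natural_MulPoly IHs IHt.
- by move=> s IHs n; rewrite natural_ExpPoly IHs.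
Qed.

End Naturality.

(** * Tarski transfer between two real closed fields *)

Section Transfer.
Import qe_rcf.
Local Notation term := (qe_rcf.term rat).
Local Notation formula := (qe_rcf.formula rat).
Implicit Types (F : rcfType) (c : seq term * seq term).

Definition tev F (e : seq F) (t : term) : F := eval e (tmap (@ratr F) t).

(** A clause is a list of terms required to vanish and a list of terms required to be positive,
    which is the input format of [CcountGt0]. *)
Definition cl_holds F (e : seq F) c : bool :=
  all (fun t => tev e t == 0) c.1 && all (fun t => 0 < tev e t) c.2.

Definition dnf_holds F (e : seq F) (D : seq (seq term * seq term)) : bool :=
  has (cl_holds e) D.

Definition dnf_and (D1 D2 : seq (seq term * seq term)) :=
  [seq (c1.1 ++ c2.1, c1.2 ++ c2.2) | c1 <- D1, c2 <- D2].

Lemma dnf_andE F (e : seq F) D1 D2 :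
  dnf_holds e (dnf_and D1 D2) = dnf_holds e D1 && dnf_holds e D2.
Proof.
have cl_catE c1 c2 : cl_holds e (c1.1 ++ c2.1, c1.2 ++ c2.2)
    = cl_holds e c1 && cl_holds e c2.
  by rewrite /cl_holds /= !all_cat andbACA.
rewrite /dnf_holds /dnf_and; elim: D1 => //= c1 D1 IH.
rewrite has_cat IH has_map andb_orl; congr (_ || _).
by elim: D2 {IH} => [|c2 D2 IH] /=; rewrite ?andbF // cl_catE IH andb_orr.
Qed.

Lemma dnf_catE F (e : seq F) D1 D2 :
  dnf_holds e (D1 ++ D2) = dnf_holds e D1 || dnf_holds e D2.
Proof. exact: has_cat. Qed.

Lemma qf_dnf (f : formula) : exists D, forall F (e : seq F),
  qf_eval e (fmap (@ratr F) f) = dnf_holds e D.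
Proof.
(* The boolean [b] is a pending negation, pushed down to the atoms. There it disappears: by totality
   of the order, a negated atom is again a disjunction of equations and strict inequalities. *)
suff h b : exists D, forall F (e : seq F),
    qf_eval e (fmap (@ratr F) f) (+) b = dnf_holds e D.
  by have [D hD] := h false; exists D => F e; rewrite -hD addbF.
have tevB F (e : seq F) s t : tev e (Add s (Opp t)) = tev e s - tev e t by [].
elim: f b => [b'|s t|s t|s t|f IHf g IHg|f IHf g IHg|f IHf g IHg|f IHf] b /=.
- exists (if b' (+) b then [:: ([::], [::])] else [::]) => F e.
  by rewrite /dnf_holds; case: (b' (+) b).
- exists (if b then [:: ([::], [:: Add s (Opp t)]); ([::], [:: Add t (Opp s)])]
          else [:: ([:: Add s (Opp t)], [::])]) => F e.
  rewrite -!/(tev e _) /dnf_holds; case: b => /=; rewrite /cl_holds /= !tevB.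
    by rewrite !subr_gt0 orbF !andbT addbT neq_lt orbC.
  by rewrite subr_eq0 !andbT orbF addbF.
- exists (if b then [:: ([:: Add s (Opp t)], [::]); ([::], [:: Add s (Opp t)])]
          else [:: ([::], [:: Add t (Opp s)])]) => F e.
  rewrite -!/(tev e _) /dnf_holds; case: b => /=; rewrite /cl_holds /= !tevB.
    by rewrite subr_eq0 subr_gt0 orbF !andbT addbT -leNgt le_eqVlt eq_sym.
  by rewrite subr_gt0 !andbT orbF addbF.
- exists (if b then [:: ([::], [:: Add s (Opp t)])]
     else [:: ([:: Add s (Opp t)], [::]); ([::], [:: Add t (Opp s)])]) => F e.
  rewrite -!/(tev e _) /dnf_holds; case: b => /=; rewrite /cl_holds /= !tevB.
    by rewrite subr_gt0 orbF !andbT addbT -ltNge.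
  by rewrite subr_eq0 subr_gt0 !andbT orbF addbF le_eqVlt.
- have [D1 h1] := IHf b; have [D2 h2] := IHg b.
  exists (if b then D1 ++ D2 else dnf_and D1 D2) => F e.
  case: b h1 h2 => h1 h2; rewrite ?dnf_catE ?dnf_andE -h1 -h2.
    by rewrite !addbT negb_and.
  by rewrite !addbF.
- have [D1 h1] := IHf b; have [D2 h2] := IHg b.
  exists (if b then dnf_and D1 D2 else D1 ++ D2) => F e.
  case: b h1 h2 => h1 h2; rewrite ?dnf_catE ?dnf_andE -h1 -h2.
    by rewrite !addbT negb_or.
  by rewrite !addbF.
- have [D1 h1] := IHf (~~ b); have [D2 h2] := IHg b.
  exists (if b then dnf_and D1 D2 else D1 ++ D2) => F e.
  case: b h1 h2 => h1 h2; rewrite ?dnf_catE ?dnf_andE -h1 -h2.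
    by rewrite /= addbF !addbT negb_imply.
  by rewrite /= addbT !addbF implybE.
have [D h] := IHf (~~ b); exists D => F e.
by rewrite -h addNb addbN.
Qed.

(** The quantifier distributes over the disjunction, and [CcountGt0] decides it for each clause. By
    [natural_CcountGt0] the resulting formula has rational constants and is the same for all [F], so
    [D'] can be chosen before the field. *)
Lemma dnf_exists i D : exists D', forall F (e : seq F),
  dnf_holds e D' <-> exists x, dnf_holds (set_nth 0 e i x) D.
Proof.
elim: D => [|c D [D' hD']].
  by exists [::] => F e; split=> // -[].
have [D1 hD1] := qf_dnf (CcountGt0 (map (abstrX i) c.1) (map (abstrX i) c.2)).
exists (D1 ++ D') => F e; rewrite dnf_catE.
have hc : dnf_holds e D1 <-> exists x, cl_holds (set_nth 0 e i x) c.
  rewrite -hD1 natural_CcountGt0 eval_CcountGt0.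
  rewrite -!map_comp.
  rewrite -(rwP (qe_rcf_th.ccount_gt0P _ _)).
  have E x t : (eval_poly e (map (tmap (@ratr F)) (abstrX i t))).[x]
      = tev (set_nth 0 e i x) t.
    by rewrite natural_abstrX abstrXP.
  have Ex x : cl_holds (set_nth 0 e i x) c =
      all (fun t => (eval_poly e (map (tmap (@ratr F)) (abstrX i t))).[x] == 0) c.1
      && all (fun t => 0 < (eval_poly e (map (tmap (@ratr F)) (abstrX i t))).[x]) c.2.
    by congr (_ && _); apply: eq_all => t; rewrite E.
  by split=> -[x hx]; exists x; move: hx; rewrite Ex !big_all !all_map.
split=> [/orP[/hc[x hx]|/hD'[x hx]]|[x /= /orP[hx|hx]]].
- by exists x; rewrite /= hx.
- by exists x; rewrite /=; apply/orP; right.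
- by apply/orP; left; apply/hc; exists x.
- by apply/orP; right; apply/hD'; exists x.
Qed.

Lemma dnf_exists_seq (s : seq nat) D : exists D', forall F (e : seq F),
  dnf_holds e D' <->
  exists2 x : seq F, size x = size s &
    dnf_holds (foldr (fun ix e => set_nth 0 e ix.1 ix.2) e (zip s x)) D.
Proof.
elim: s D => [|i s IH] D.
  exists D => F e; split; first by move=> h; exists [::].
  by case=> -[].
have [D1 h1] := dnf_exists i D; have [D' h'] := IH D1.
exists D' => F e; split.
  case/h' => x sx /h1[y hy]; exists (y :: x) => //=.
  by rewrite sx.
case=> -[|y x] //= [sx] h; apply/h'; exists x => //.
by apply/h1; exists y.
Qed.

(** Elimination leaves a quantifier-free condition on the signs of rational terms in the parameters.
    Agreement on positivity is enough: applied to a term and to its opposite, it gives agreement on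
    vanishing. *)
Lemma tarski_transfer F1 F2 (e1 : seq F1) (e2 : seq F2) (s : seq nat) D (x1 : seq F1) :
  (forall t, (0 < tev e1 t) = (0 < tev e2 t)) ->
  size x1 = size s ->
  dnf_holds (foldr (fun ix e => set_nth 0 e ix.1 ix.2) e1 (zip s x1)) D ->
  exists2 x2 : seq F2, size x2 = size s &
    dnf_holds (foldr (fun ix e => set_nth 0 e ix.1 ix.2) e2 (zip s x2)) D.
Proof.
move=> sgn sz h; have [D' hD'] := dnf_exists_seq s D; apply/hD'.
have : dnf_holds e1 D' by apply/hD'; exists x1.
apply: sub_has => c /andP[h1 h2].
apply/andP; split; last by apply: sub_all h2 => t; rewrite sgn.
apply: sub_all h1 => t /eqP t0.
have tevN F (e : seq F) u : tev e (Opp u) = - tev e u by [].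
have := sgn (Opp t); have := sgn t; rewrite !tevN !oppr_gt0 t0 ltxx.
by move=> /esym/negbT; rewrite -leNgt => ? /esym/negbT; rewrite -leNgt => ?; rewrite eq_le; apply/andP.
Qed.
End Transfer.

(** * Real closure of an ordered field inside an algebraically closed one *)

Lemma Zorn_above (T : Type) (Q : set (set T)) (A0 : set T) :
  Q A0 ->
  (forall F : set (set T), F !=set0 -> F `<=` Q -> total_on F subset ->
     Q (\bigcup_(X in F) X)) ->
  exists A, [/\ A0 `<=` A, Q A & forall B, A `<=` B -> Q B -> B `<=` A].
Proof.
move=> Q0 Qch.
have [[A [QA Amax]]|] := pselect (exists A, (A = set0 \/ (A0 `<=` A /\ Q A)) /\
    forall B, A `<` B -> ~ (B = set0 \/ (A0 `<=` B /\ Q B))); last first.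
  case; apply: (@Zorn_bigcup _ (fun A => A = set0 \/ (A0 `<=` A /\ Q A))).
  move=> F FP Ftot.
  pose F' := [set X | F X /\ X <> set0].
  have FF' : \bigcup_(X in F) X = \bigcup_(X in F') X.
    apply/seteqP; split=> x [X FX Xx]; last by exists X => //; case: FX.
    by exists X => //; split=> // X0; rewrite X0 in Xx.
  have [[X0 F'X0]|F'0] := pselect (F' !=set0); last first.
    left; rewrite FF'; apply/seteqP; split=> // x [X F'X _].
    by case: F'0; exists X.
  right; rewrite FF'; split.
    case: (F'X0) => FX0 n0 x A0x; exists X0 => //.
    by case: (FP _ FX0) => // -[s _]; apply: s.
  apply: Qch; first by exists X0.
    by move=> X [FX n0]; case: (FP _ FX) => // -[].
  by move=> X Y [FX _] [FY _]; apply: Ftot.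
case: QA => [A_0|[A0A QA]].
  have A00 : A0 = set0.
    apply: contrapT => /eqP/set0P[x A0x]; apply: (Amax A0); last by right; split.
    by rewrite A_0; split=> // /(_ _ A0x).
  exists A0; split=> // B A0B QB; rewrite A00.
  have [->//|/set0P[x Bx]] := eqVneq B set0.
  exfalso; apply: (Amax B); last by right; rewrite A00; split.
  by rewrite A_0; split=> // /(_ _ Bx).
exists A; split=> // B AB QB x Bx.
apply: contrapT => nAx; apply: (Amax B); last by right; split=> //; apply: subset_trans AB.
by split=> // BA; apply/nAx/BA.
Qed.

(** The nonnegative elements of an ordered subfield of [C] that is not fixed in advance: it consists
    of the differences of elements of [P]. Only the squares of such differences are required to be
    in [P] by [ocS], since in an algebraically closed field [- 1] is a square too. *)
Record ordcone (C : fieldType) (P : set C) : Prop := Ordcone {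
  oc1 : P 1;
  ocD : forall x y, P x -> P y -> P (x + y);
  ocM : forall x y, P x -> P y -> P (x * y);
  ocS : forall x y, P x -> P y -> P ((x - y) ^+ 2);
  ocV : forall x, P x -> P x^-1;
  ocN : ~ P (- 1) }.

Lemma ordcone_chain (C : fieldType) (F : set (set C)) :
  F !=set0 -> F `<=` @ordcone C -> total_on F subset ->
  ordcone (\bigcup_(X in F) X).
Proof.
move=> [X0 FX0] FP Ftot.
have two x y : (\bigcup_(X in F) X) x -> (\bigcup_(X in F) X) y ->
    exists X, [/\ F X, X x & X y].
  move=> [X FX Xx] [Y FY Yy]; case: (Ftot _ _ FX FY) => s.
    by exists Y; split=> //; apply: s.
  by exists X; split=> //; apply: s.
split.
- by exists X0 => //; apply: (oc1 (FP _ FX0)).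
- by move=> x y Px /(two _ _ Px)[X [FX ? ?]]; exists X => //; apply: (ocD (FP _ FX)).
- by move=> x y Px /(two _ _ Px)[X [FX ? ?]]; exists X => //; apply: (ocM (FP _ FX)).
- by move=> x y Px /(two _ _ Px)[X [FX ? ?]]; exists X => //; apply: (ocS (FP _ FX)).
- by move=> x [X FX Xx]; exists X => //; apply: (ocV (FP _ FX)).
- by move=> [X FX]; apply: (ocN (FP _ FX)).
Qed.

(** Maximality is among all cones of [C], so that neither the order nor the subfield it lives on can
    be enlarged. *)
Record maxcone (C : closedFieldType) := Maxcone {
  mcone : set C;
  mconeP : ordcone mcone;
  mcone_max : forall Q, mcone `<=` Q -> ordcone Q -> Q `<=` mcone }.

Lemma maxcone_exists (C : closedFieldType) (P0 : set C) : ordcone P0 ->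
  exists P : maxcone C, P0 `<=` mcone P.
Proof.
move=> h0; have [P [s h m]] := Zorn_above h0 (@ordcone_chain C).
by exists (Maxcone h m).
Qed.

(** * The ordered subfield defined by a maximal cone *)

Section RClosure.
Variables (C : closedFieldType) (M : maxcone C).
Local Notation P := (mcone M).

Let h := mconeP M.

Definition rdom : {pred C} := fun x => `[< exists a b, [/\ P a, P b & x = a - b] >].

Lemma rdomP x : reflect (exists a b, [/\ P a, P b & x = a - b]) (x \in rdom).
Proof. exact: asboolP. Qed.

Lemma maxcone0 : P 0.
Proof. by have := ocS h (oc1 h) (oc1 h); rewrite subrr expr0n. Qed.

Lemma P_rdom x : P x -> x \in rdom.
Proof. by move=> Px; apply/rdomP; exists x, 0; split; rewrite ?subr0 //; apply: maxcone0. Qed.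

Lemma rdom_sqr x : x \in rdom -> P (x ^+ 2).
Proof. by case/rdomP => a [b [Pa Pb ->]]; apply: (ocS h). Qed.

Lemma rdomB x y : x \in rdom -> y \in rdom -> x - y \in rdom.
Proof.
move=> /rdomP[a [b [Pa Pb ->]]] /rdomP[c [d [Pc Pd ->]]]; apply/rdomP.
exists (a + d), (b + c); split; [exact: (ocD h)|exact: (ocD h)|ring].
Qed.

Lemma rdomM x y : x \in rdom -> y \in rdom -> x * y \in rdom.
Proof.
move=> /rdomP[a [b [Pa Pb ->]]] /rdomP[c [d [Pc Pd ->]]]; apply/rdomP.
exists (a * c + b * d), (a * d + b * c); split; last ring.
  by apply: (ocD h) => //; apply: (ocM h).
by apply: (ocD h) => //; apply: (ocM h).
Qed.

Lemma rdomV x : x \in rdom -> x^-1 \in rdom.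
Proof.
move=> xd; have [->|x0] := eqVneq x 0; first by rewrite invr0; exact: P_rdom maxcone0.
have -> : x^-1 = x * (x ^+ 2)^-1 by field; rewrite ?x0.
by exact: (rdomM xd (P_rdom (ocV h (rdom_sqr xd)))).
Qed.

Lemma rdom1 : 1 \in rdom. Proof. exact: P_rdom (oc1 h). Qed.

Lemma rdom_divring : GRing.divring_closed rdom.
Proof.
split; [exact: rdom1|exact: rdomB|].
by move=> x y xd yd; apply: rdomM => //; apply: rdomV.
Qed.

HB.instance Definition _ := GRing.isDivringClosed.Build C rdom rdom_divring.

Lemma P_anti x : P x -> P (- x) -> x = 0.
Proof.
move=> Px PNx; apply/eqP/negPn/negP => x0; apply: (ocN h).
by rewrite -(mulVf x0) -mulrN; apply: (ocM h) => //; apply: (ocV h).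
Qed.

(** Otherwise [P + P a] would satisfy all the axioms of a cone, and maximality would put [a] into
    [P]. Inverses cause no difficulty, because the inverse of [x] is [x] times the square of an
    element of the subfield. *)
Lemma P_adjoin a : a \in rdom -> ~ P a -> exists s t, [/\ P s, P t & - 1 = s + t * a].
Proof.
move=> ad nPa; apply: contrapT => nex; apply: nPa.
pose Q := [set x | exists s t, [/\ P s, P t & x = s + t * a]].
have Qd x : Q x -> x \in rdom.
  move=> [s [t [Ps Pt ->]]]; apply: rpredD; first exact: P_rdom.
  by apply: rpredM => //; apply: P_rdom.
have PQ : P `<=` Q.
  by move=> x Px; exists x, 0; split=> //; rewrite ?mul0r ?addr0 //; apply: maxcone0.
have QM x y : Q x -> Q y -> Q (x * y).
  move=> [s [t [Ps Pt ->]]] [s' [t' [Ps' Pt' ->]]].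
  exists (s * s' + t * t' * a ^+ 2), (s * t' + t * s'); split; last ring.
    apply: (ocD h); first exact: (ocM h).
    by apply: (ocM h); [exact: (ocM h)|exact: rdom_sqr].
  by apply: (ocD h); apply: (ocM h).
have oQ : ordcone Q.
  split.
  - exact: PQ (oc1 h).
  - move=> _ _ [s [t [Ps Pt ->]]] [s' [t' [Ps' Pt' ->]]].
    by exists (s + s'), (t + t'); split; [exact: (ocD h)|exact: (ocD h)|ring].
  - exact: QM.
  - by move=> x y /Qd xd /Qd yd; apply/PQ/rdom_sqr/rpredB.
  - move=> x Qx; have [->|x0] := eqVneq x 0.
      by rewrite invr0; apply/PQ/maxcone0.
    have -> : x^-1 = x * (x^-1) ^+ 2 by field; rewrite ?x0.
    by apply: QM => //; apply/PQ/rdom_sqr/rdomV/Qd.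
  - by move=> [s [t [Ps Pt E]]]; apply: nex; exists s, t.
apply: (mcone_max PQ oQ); exists 0, 1; split; [exact: maxcone0|exact: (oc1 h)|ring].
Qed.

(** If both fail, then [t * a = - (1 + s)] and [t' * a = 1 + s']; multiplying these writes [- 1] as
    [s + s' + s * s' + t * t' * a ^+ 2], an element of [P]. *)
Lemma P_total a : a \in rdom -> P a \/ P (- a).
Proof.
move=> ad; apply: contrapT => /not_orP[nP nPN]; apply: (ocN h).
have [s [t [Ps Pt E]]] := P_adjoin ad nP.
have ad' : - a \in rdom by rewrite rpredN.
have [s' [t' [Ps' Pt' E']]] := P_adjoin ad' nPN.
have -> : - 1 = s + s' + s * s' + t * t' * a ^+ 2.
  have e1 : t * a = - 1 - s by rewrite E; ring.
  have e2 : t' * a = 1 + s' by rewrite -[1]opprK E'; ring.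
  have -> : t * t' * a ^+ 2 = (t * a) * (t' * a) by ring.
  by rewrite e1 e2; ring.
apply: (ocD h); last first.
  by apply: (ocM h); [exact: (ocM h)|exact: rdom_sqr].
by apply: (ocD h); [exact: (ocD h)|exact: (ocM h)].
Qed.

Record rclosure := in_rclosure { rval :> C; rvalP : rval \in rdom }.

HB.instance Definition _ := [isSub for rval].
HB.instance Definition _ := [Choice of rclosure by <:].
HB.instance Definition _ := [SubChoice_isSubIntegralDomain of rclosure by <:].
HB.instance Definition _ := [SubIntegralDomain_isSubField of rclosure by <:].

Lemma rval_is_zmod_morphism : zmod_morphism rval. Proof. by []. Qed.
Lemma rval_is_monoid_morphism : monoid_morphism rval. Proof. by []. Qed.
HB.instance Definition _ := GRing.isZmodMorphism.Build rclosure C rval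
  rval_is_zmod_morphism.
HB.instance Definition _ := GRing.isMonoidMorphism.Build rclosure C rval
  rval_is_monoid_morphism.

Definition rle (x y : rclosure) : bool := `[< P (rval y - rval x) >].
Definition rlt (x y : rclosure) : bool := (y != x) && rle x y.
Definition rnorm (x : rclosure) : rclosure := if rle 0 x then x else - x.

Lemma rle0E x : rle 0 x = `[< P (rval x) >].
Proof. by rewrite /rle rmorph0 subr0. Qed.

Lemma rle0_add x y : rle 0 x -> rle 0 y -> rle 0 (x + y).
Proof.
rewrite !rle0E => /asboolP Px /asboolP Py; apply/asboolP.
by rewrite rmorphD; apply: (ocD h).
Qed.
Lemma rle0_mul x y : rle 0 x -> rle 0 y -> rle 0 (x * y).
Proof.
rewrite !rle0E => /asboolP Px /asboolP Py; apply/asboolP.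
by rewrite rmorphM; apply: (ocM h).
Qed.
Lemma rle0_anti x : rle 0 x -> rle x 0 -> x = 0.
Proof.
rewrite rle0E /rle rmorph0 sub0r => /asboolP Px /asboolP Py.
by apply/val_inj/P_anti.
Qed.
Lemma rsub_ge0 x y : rle 0 (y - x) = rle x y.
Proof. by rewrite rle0E rmorphB. Qed.
Lemma rle0_total x : rle 0 x || rle x 0.
Proof.
rewrite rle0E /rle rmorph0 sub0r; apply/orP.
by case: (P_total (rvalP x)) => ?; [left|right]; apply/asboolP.
Qed.
Lemma rnormN x : rnorm (- x) = rnorm x.
Proof.
have E : rle 0 (- x) = rle x 0 by rewrite -sub0r rsub_ge0.
rewrite /rnorm E opprK; case: (boolP (rle x 0)); case: (boolP (rle 0 x)) => //.
  by move=> a b; rewrite (rle0_anti a b) oppr0.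
by move=> /negPf a /negPf b; have := rle0_total x; rewrite a b.
Qed.
Lemma rge0_norm x : rle 0 x -> rnorm x = x.
Proof. by rewrite /rnorm => ->. Qed.

HB.instance Definition _ := Num.IntegralDomain_isLeReal.Build rclosure
  rle0_add rle0_mul rle0_anti rsub_ge0 rle0_total rnormN rge0_norm
  (fun x y => erefl).

Lemma rclosure_ge0 (x : rclosure) : 0 <= x <-> P (rval x).
Proof. by have -> : (0 <= x) = rle 0 x by []; rewrite rle0E; split=> /asboolP. Qed.

End RClosure.

(** * Sums of squares modulo a polynomial that changes sign *)

Section SignChange.
Variable F : realFieldType.
Implicit Types p q f g : {poly F}.

(** The weights [c] are kept apart because a nonnegative element of [F] need not have a square root
    in [F]. *)
Inductive wsos : {poly F} -> Prop :=
| wsos0 : wsos 0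
| wsosA c f g : 0 <= c -> wsos g -> wsos (c *: f ^+ 2 + g).

Lemma wsosD f g : wsos f -> wsos g -> wsos (f + g).
Proof.
elim=> [|c f1 f2 c0 _ IH] wg; first by rewrite add0r.
by rewrite -addrA; apply: wsosA => //; apply: IH.
Qed.

Lemma wsosZ c f : 0 <= c -> wsos (c *: f ^+ 2).
Proof. by move=> c0; rewrite -[_ *: _]addr0; apply: wsosA => //; apply: wsos0. Qed.

Lemma wsosM f g : wsos f -> wsos g -> wsos (f * g).
Proof.
elim=> [|c f1 f2 c0 _ IH] wg; first by rewrite mul0r; apply: wsos0.
rewrite mulrDl; apply: wsosD; last exact: IH.
elim: wg => [|d g1 g2 d0 _ IHg]; first by rewrite mulr0; apply: wsos0.
rewrite mulrDr; apply: wsosD => //.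
by rewrite -scalerAl -scalerAr scalerA -exprMn; apply: wsosZ; apply: mulr_ge0.
Qed.

Lemma wsos_ge0 g a : wsos g -> 0 <= g.[a].
Proof.
elim=> [|c f g' c0 _ IH]; first by rewrite horner0.
by rewrite hornerD hornerZ horner_exp addr_ge0 // mulr_ge0 // sqr_ge0.
Qed.

(** Each square [f ^+ 2] is replaced by [(f %% p) ^+ 2] with the same weight. The bound on sizes
    means degree at most [2 * deg p - 2]. *)
Lemma wsos_modp p g : (1 < size p)%N -> wsos g -> exists g', [/\ wsos g',
  p %| g - g' & (size g' <= ((size p).-1 + (size p).-1).-1)%N].
Proof.
move=> sp; have p0 : p != 0 by rewrite -size_poly_gt0; apply: ltn_trans sp.
elim=> [|c f g1 c0 _ [g' [wg' pg sg]]].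
  by exists 0; rewrite subrr dvdp0 size_poly0; split=> //; apply: wsos0.
exists (c *: (f %% p) ^+ 2 + g'); split; first exact: wsosA.
  rewrite opprD addrACA; apply: dvdp_add => //.
  rewrite -scalerBr -mul_polyC; apply: dvdp_mull; rewrite subr_sqr; apply: dvdp_mulr.
  by rewrite /dvdp modpD modpN modp_id subrr.
apply: leq_trans (size_polyD _ _) _; rewrite geq_max sg andbT.
apply: leq_trans (size_scale_leq _ _) _.
rewrite expr2; apply: leq_trans (size_polyMleq _ _) _.
have : (size (f %% p)%R <= (size p).-1)%N by rewrite -ltnS prednK ?ltn_modp // ltnW.
by move=> hh; have := leq_add hh hh; move: (_ + _)%N => u; lia.
Qed.

(* A counterexample [p] of minimal degree produces the cofactor of [p] in
   [1 + g] (with [g] reduced modulo [p]) as a smaller one. *)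
Lemma sign_change_ndvd p g a b : p.[a] * p.[b] < 0 -> wsos g -> ~~ (p %| 1 + g).
Proof.
have [m sm] := ubnP (size p); elim: m p g sm => // m IH p g sm pab wg.
apply/negP => pg.
have sp : (1 < size p)%N.
  rewrite ltnNge; apply/negP => /size1_polyC E.
  by move: pab; rewrite E !hornerC -expr2 ltNge sqr_ge0.
have [g' [wg' pg' sg']] := wsos_modp sp wg.
have {}pg' : p %| 1 + g'.
  have -> : 1 + g' = (1 + g) - (g - g') by ring.
  exact: dvdp_sub.
pose q : {poly F} := (1 + g') %/ p.
have E : 1 + g' = q * p by rewrite divpK.
(* The product [q * p = 1 + g'] is positive everywhere, so [q] has the sign of [p] at [a] and at
   [b]. *)
have pos c : 0 < q.[c] * p.[c].
  rewrite -hornerM -E hornerD hornerC ltr_pwDl //; exact: wsos_ge0.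
have qab : q.[a] * q.[b] < 0.
  have := mulr_gt0 (pos a) (pos b); rewrite mulrACA.
  by rewrite (nmulr_lgt0 _ pab).
have p0 : p != 0 by rewrite -size_poly_gt0; apply: ltn_trans sp.
suff sq : (size q < m)%N by have := IH q g' sq qab wg'; rewrite E dvdp_mulr.
have sg2 : (size (1 + g')%R <= ((size p).-1 + (size p).-1).-1)%N.
  apply: leq_trans (size_polyD _ _) _; rewrite geq_max sg' size_poly1 andbT.
  by move: (size p) sp => [|[|k]] //; rewrite addnS.
rewrite /q size_divp //.
move: (size (1 + g')%R) (size p) sp sm sg2 => u v; lia.
Qed.
End SignChange.

(** * Intermediate value property of the ordered subfield *)

Section IVT.
Variables (C : closedFieldType) (M : maxcone C).
Local Notation P := (mcone M).
Local Notation L := (rclosure M).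
Let h := mconeP M.

Variables (p : {poly L}) (a b : L).
Hypothesis pab : p.[a] * p.[b] < 0.
Hypothesis irr : forall d, d %| p -> (1 < size d)%N -> size d = size p.

(** Let [t] be a root of [p] in [C]. The values at [t] of weighted sums of squares form a cone:
    inverses exist because [p] is irreducible, and [- 1] is excluded by [sign_change_ndvd]. This
    cone contains [P], so by maximality it is [P], and this forces [t] into the subfield. *)
Lemma irr_root : exists2 x, p.[x] = 0 & forall q : {poly L}, q.[x] = 0 -> p %| q.
Proof.
have p0 : p != 0 by apply: contraTneq pab => ->; rewrite !horner0 mul0r ltxx.
have sp : (1 < size p)%N.
  rewrite ltnNge; apply/negP => /size1_polyC E.
  by move: pab; rewrite E !hornerC -expr2 ltNge sqr_ge0.
have [t rt] : exists t, root (map_poly (@rval C M) p) t.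
  by apply/closed_rootP; rewrite size_map_poly neq_ltn sp orbT.
pose ev (f : {poly L}) : C := (map_poly (@rval C M) f).[t].
have evD f g : ev (f + g) = ev f + ev g by rewrite /ev rmorphD hornerD.
have evB f g : ev (f - g) = ev f - ev g by rewrite /ev rmorphB hornerD hornerN.
have evM f g : ev (f * g) = ev f * ev g by rewrite /ev rmorphM hornerM.
have ev1 : ev 1 = 1 by rewrite /ev rmorph1 hornerC.
have evC c : ev c%:P = rval c by rewrite /ev map_polyC hornerC.
have evp : ev p = 0 by apply/rootP.
have evker f : ev f = 0 -> p %| f.
  move=> f0.
  have rg : root (map_poly (@rval C M) (gcdp p f)) t.
    by rewrite gcdp_map root_gcd rt; apply/eqP.
  have sg : (1 < size (gcdp p f))%N.
    have g0 : gcdp p f != 0 by rewrite gcdp_eq0 negb_and p0.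
    rewrite ltnNge; apply/negP => /size1_polyC E.
    move: rg g0; rewrite E map_polyC rootC fmorph_eq0 polyC_eq0.
    by move=> ->.
  have /eqP := irr (dvdp_gcdl p f) sg; rewrite dvdp_size_eqp ?dvdp_gcdl // => e.
  by rewrite -(eqp_dvdl _ e) dvdp_gcdr.
pose Q := [set x | exists2 f, wsos f & x = ev f].
have Q_sqr f : Q (ev f ^+ 2).
  exists (1 *: f ^+ 2); first exact: wsosZ.
  by rewrite scale1r expr2 evM.
have QM x y : Q x -> Q y -> Q (x * y).
  by move=> [f wf ->] [g wg ->]; exists (f * g); [exact: wsosM|rewrite evM].
have evV f : exists g, (ev f)^-1 = ev g.
  have [f0|/eqP f0] := eqVneq (ev f) 0.
    by exists 0; rewrite f0 invr0 /ev rmorph0 horner0.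
  have cop : coprimep p f.
    rewrite coprimep_def eqn_leq; apply/andP; split; last first.
      by rewrite lt0n size_poly_eq0 gcdp_eq0 negb_and p0.
    rewrite leqNgt; apply/negP => sg.
    have /eqP := irr (dvdp_gcdl p f) sg; rewrite dvdp_size_eqp ?dvdp_gcdl // => e.
    have : p %| f by rewrite -(eqp_dvdl _ e) dvdp_gcdr.
    move=> /dvdpP[c E]; by apply: f0; rewrite E evM evp mulr0.
  have /Bezout_eq1_coprimepP[[u v] /= E] := cop.
  exists v; apply: (mulIf (introN eqP f0)); rewrite mulVf ?(introN eqP f0) //.
  by rewrite -evM -ev1 -E evD [ev (u * p)]evM evp mulr0 add0r.
have PQ : P `<=` Q.
  move=> x Px; pose y : L := in_rclosure (P_rdom Px).
  have y0 : 0 <= y by apply/rclosure_ge0.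
  exists (y *: 1 ^+ 2); first exact: wsosZ.
  by rewrite expr1n -mul_polyC mulr1 evC.
have oQ : ordcone Q.
  split.
  - exact: PQ (oc1 h).
  - by move=> x y [f wf ->] [g wg ->]; exists (f + g); [exact: wsosD|rewrite evD].
  - exact: QM.
  - by move=> _ _ [f wf ->] [g wg ->]; rewrite -evB.
  - move=> x Qx; have [->|x0] := eqVneq x 0; first by rewrite invr0; exact: PQ (maxcone0 M).
    have -> : x^-1 = x * (x^-1) ^+ 2 by field; rewrite ?x0.
    apply: QM => //; case: Qx => f _ ->; have [g ->] := evV f; exact: Q_sqr.
  - move=> [f wf E].
    have : p %| 1 + f by apply: evker; rewrite evD ev1 -E subrr.
    by apply/negP/(sign_change_ndvd pab).
have QP := mcone_max PQ oQ.
(* Here [t] is the difference of the squares of [(t + 1) / 2] and [(t - 1) / 2], both of which are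
   now known to lie in [P]. *)
have td : t \in rdom M.
  have two0 : (2 : C) != 0.
    apply/eqP => two0; apply: (ocN h).
    have -> : -1 = 1 :> C by apply/eqP; rewrite eq_sym -addr_eq0 -mulr2n two0.
    exact: oc1.
  have evX : ev 'X = t by rewrite /ev map_polyX hornerX.
  apply/rdomP; exists (ev ((1/2)%:P * ('X + 1)) ^+ 2), (ev ((1/2)%:P * ('X - 1)) ^+ 2).
  split; [exact/QP/Q_sqr|exact/QP/Q_sqr|].
  rewrite !evM evD evB evX ev1 evC rmorphM rmorph1 fmorphV rmorph_nat.
  by field.
exists (in_rclosure td) => [|q q0].
  by apply: val_inj; rewrite /= -horner_map /=; apply/eqP.
apply: evker; rewrite /ev (_ : t = rval (in_rclosure td)) // horner_map q0.
by rewrite rmorph0.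
Qed.
End IVT.

Section RCF.
Variables (C : closedFieldType) (M : maxcone C).
Local Notation L := (rclosure M).

(** By induction on the degree: if [p] has a proper factor, then the factor or its cofactor takes
    values of weakly opposite signs at [a] and [b]. Otherwise [irr_root] applies. *)
Lemma rclosure_ivt (p : {poly L}) (a b : L) : a <= b -> p.[a] * p.[b] <= 0 ->
  exists2 x, a <= x <= b & root p x.
Proof.
move=> ab; have [m sm] := ubnP (size p); elim: m p sm => // m IH p sm.
rewrite le_eqVlt mulf_eq0 -orbA => /or3P[pa|pb|pab].
- by exists a; rewrite ?lexx.
- by exists b; rewrite ?lexx ?ab.
have p0 : p != 0 by apply: contraTneq pab => ->; rewrite !horner0 mul0r ltxx.
have [[d [dp sd nsd]]|nex] := pselect (exists d,
    [/\ d %| p, (1 < size d)%N & size d <> size p]).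
  have sd' : (size d < size p)%N.
    by rewrite ltn_neqAle dvdp_leq // andbT; apply/eqP.
  pose q : {poly L} := p %/ d; have E : p = q * d by rewrite divpK.
  have sq : (size q < m)%N.
    rewrite size_divp; last by rewrite -size_poly_gt0; apply: ltn_trans sd.
    move: (size p) (size d) sd sd' sm => u v; lia.
  have [qab|qab] := lerP (q.[a] * q.[b]) 0.
    have [x xab rx] := IH q sq qab.
    by exists x => //; rewrite E rootM rx.
  have [|x xab rx] := IH d (leq_trans sd' sm).
    by move: pab; rewrite E !hornerM mulrACA (pmulr_rlt0 _ qab) => /ltW.
  by exists x => //; rewrite E rootM rx orbT.
have irr d : d %| p -> (1 < size d)%N -> size d = size p.
  by move=> dp sd; apply: contrapT => nsd; apply: nex; exists d.
have [x px minx] := irr_root pab irr.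
(* Since [p] divides ['X - x%:P] it is linear, and the sign change places its root between [a] and
   [b]. *)
have /minx/dvdp_leq : ('X - x%:P).[x] = 0 by rewrite hornerXsubC subrr.
rewrite polyXsubC_eq0 size_XsubC => /(_ isT) sp2.
have /factor_theorem[q E] : root p x by apply/eqP.
have sq : (size q <= 1)%N.
  move: sp2; rewrite E size_Mmonic ?monicXsubC ?size_XsubC //; last first.
    by apply: contraNneq p0 => q0; rewrite E q0 mul0r.
  by rewrite addn2.
exists x; last by apply/eqP.
move: pab; rewrite E (size1_polyC sq) !hornerM !hornerC !hornerXsubC mulrACA.
rewrite -expr2 pmulr_rlt0; last first.
  rewrite exprn_even_gt0 //=; apply: contraNneq p0 => q0.
  by rewrite E (size1_polyC sq) q0 mul0r.
case: (lerP a x) => ax; case: (lerP x b) => xb //.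
- by rewrite ltNge mulr_le0 // subr_le0 // ltW.
- by rewrite ltNge mulr_ge0 // subr_ge0 // ltW.
- by have := lt_trans xb ax; rewrite ltNge ab.
Qed.

Lemma rclosure_closed : Num.real_closed_axiom L.
Proof.
move=> p a b ab /andP[pa pb].
by apply: rclosure_ivt => //; apply: mulr_le0_ge0.
Qed.

HB.instance Definition _ := Num.RealField_isClosed.Build L rclosure_closed.
End RCF.

(** * Real Nullstellensatz *)

Record is_ideal (B : comNzRingType) (I : set B) : Prop := IsIdeal {
  ideal_zero : I 0;
  ideal_add : forall x y, I x -> I y -> I (x + y);
  ideal_mull : forall x y, I y -> I (x * y) }.

(** Take [I] maximal among the ideals that contain [J] and miss [S]. It is prime because [S] is
    multiplicative. For the last property, if [x] is not in [I] then some [s] in [S] is congruent to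
    [b * x], so [s * s + b ^+ 2 * (x * y)], which is in [S], is congruent to the multiple
    [b ^+ 2 * x * (x + y)] of [x + y]. *)
Lemma real_prime (B : comNzRingType) (T S J : set B) :
  (forall x y, T x -> T y -> T (x + y)) -> (forall x y, T x -> T y -> T (x * y)) ->
  (forall x, T (x ^+ 2)) ->
  S `<=` T -> S 1 -> (forall x y, S x -> S y -> S (x * y)) ->
  (forall x y, S x -> T y -> S (x + y)) ->
  is_ideal J -> (forall x, S x -> ~ J x) ->
  exists I, [/\ J `<=` I, is_ideal I, (forall x, S x -> ~ I x),
    (forall x y, I (x * y) -> I x \/ I y) &
    (forall x y, T x -> T y -> I (x + y) -> I x)].
Proof.
move=> TD TM TS ST S1 SM SD Jid JS.
pose Q (I : set B) := is_ideal I /\ forall x, S x -> ~ I x.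
have [|I [JI [Iid IS] Imax]] := @Zorn_above _ Q J (conj Jid JS).
  move=> F [X0 FX0] FQ Ftot; split; last by move=> x Sx [X /FQ[_ XS]]; apply: XS.
  split.
  - by exists X0 => //; case: (FQ _ FX0) => -[].
  - move=> x y [X FX Xx] [Y FY Yy].
    have [XY|YX] := Ftot _ _ FX FY.
      by exists Y => //; case: (FQ _ FY) => -[_ D _] _; apply: D => //; apply: XY.
    by exists X => //; case: (FQ _ FX) => -[_ D _] _; apply: D => //; apply: YX.
  - by move=> x y [X FX Xy]; exists X => //; case: (FQ _ FX) => -[_ _ D] _; apply: D.
(* By maximality, an element outside [I] divides some element of [S] modulo [I]. *)
have adj a : ~ I a -> exists s b, S s /\ I (s - b * a).
  move=> nIa; apply: contrapT => nex; apply: nIa.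
  apply: (Imax [set x | exists b, I (x - b * a)]).
  - by move=> x Ix; exists 0; rewrite mul0r subr0.
  - split; last first.
      by move=> s Ss [b Ib]; apply: nex; exists s, b.
    split.
    + by exists 0; rewrite mul0r subr0; apply: (ideal_zero Iid).
    + move=> x y [b Ib] [c Ic]; exists (b + c).
      have -> : x + y - (b + c) * a = (x - b * a) + (y - c * a) by ring.
      exact: (ideal_add Iid).
    + move=> x y [b Ib]; exists (x * b).
      have -> : x * y - x * b * a = x * (y - b * a) by ring.
      exact: (ideal_mull Iid).
  - by exists 1; rewrite mul1r subrr; apply: (ideal_zero Iid).
exists I; split=> //.
- move=> x y Ixy; apply: contrapT => /not_orP[/adj[s [b [Ss Ib]]] /adj[t [c [St Ic]]]].
  apply: (IS _ (SM _ _ Ss St)).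
  have -> : s * t = t * (s - b * x) + b * x * (t - c * y) + b * c * (x * y) by ring.
  by apply: (ideal_add Iid); [apply: (ideal_add Iid)|]; apply: (ideal_mull Iid).
- move=> x y Tx Ty Ixy; apply: contrapT => /adj[s [b [Ss Ib]]].
  have TSb : T (b ^+ 2 * (x * y)) by exact: (TM _ _ (TS _) (TM _ _ Tx Ty)).
  apply: (IS _ (SD _ _ (SM _ _ Ss Ss) TSb)).
  have -> : s * s + b ^+ 2 * (x * y) =
      (s + b * x) * (s - b * x) + b ^+ 2 * x * (x + y) by ring.
  by apply: (ideal_add Iid); apply: (ideal_mull Iid).
Qed.

(** * Residue field of a prime ideal *)

Section ResidueField.
Variables (B : comNzRingType) (I : prime_idealr B).
Local Notation Q := {ideal_quot I}.

(* An integral domain of MathComp is a ring with inverses, which are chosen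
   classically here. *)
Definition quot_unit : {pred Q} := fun x => `[< exists y, y * x = 1 >].
Definition quot_inv (x : Q) : Q :=
  if pselect (exists y, y * x = 1) is left h then projT1 (cid h) else x.

Lemma quot_mulVx : {in quot_unit, left_inverse 1 quot_inv *%R}.
Proof.
move=> x /asboolP ex; rewrite /quot_inv; case: pselect => // h.
by case: (cid h).
Qed.
Lemma quot_unitPl (x y : Q) : y * x = 1 -> quot_unit x.
Proof. by move=> h; apply/asboolP; exists y. Qed.
Lemma quot_invr_out : {in [predC quot_unit], quot_inv =1 id}.
Proof.
by move=> x /= /asboolP ne; rewrite /quot_inv; case: pselect.
Qed.

HB.instance Definition _ := GRing.ComNzRing_hasMulInverse.Build Q
  quot_mulVx quot_unitPl quot_invr_out.
HB.instance Definition _ := GRing.ComUnitRing_isIntegral.Build Q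
  (@Quotient.rquot_IdomainAxiom B I).

Variables (enc : B -> nat) (dec : nat -> option B).
Hypothesis encK : pcancel enc dec.
Local Notation K := {fraction Q}.

Local Open Scope quotient_scope.
(** The residue field is the fraction field of the quotient. Encoding the representatives of a
    numerator and a denominator makes it countable, hence it has an algebraic closure. *)
Lemma residue_closure : exists (C : closedFieldType) (chi : {rmorphism B -> C}),
  forall x, chi x = 0 <-> x \in I.
Proof.
pose f (x : K) : nat * nat :=
  (enc (repr (frac (repr x)).1), enc (repr (frac (repr x)).2)).
pose g (m : nat * nat) : option K :=
  if dec m.1 is Some a then if dec m.2 is Some b then
    Some (\pi_K (Ratio (\pi_Q a) (\pi_Q b))) else None else None.
have fK : pcancel f g.
  by move=> x; rewrite /f /g /= !encK !reprK Ratio_numden reprK.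
pose K' : countFieldType := HB.pack K (PCanIsCountable fK).
have [C [iota _]] := countable_algebraic_closure K'.
pose chi : {rmorphism B -> C} := iota \o (@FracField.tofrac Q : {rmorphism Q -> K'})
   \o (\pi_Q : {rmorphism B -> Q}).
exists C, chi => x; rewrite (rwP eqP) /= fmorph_eq0 (@tofrac_eq0 Q).
have -> : (x \in I) = (\pi_Q x == \pi_Q 0) by rewrite -Quotient.idealrBE subr0.
by rewrite (_ : \pi_Q 0 = 0) // rmorph0.
Qed.
End ResidueField.

(** Fractions are written with square denominators, so that the numerators stay in [T]. If [- 1]
    were such a fraction, then [d ^+ 2 + t] would be in [I], hence also [d ^+ 2], although [chi d]
    is nonzero. *)
Lemma residue_cone (B : comNzRingType) (T : set B) (I : set B)
    (C : closedFieldType) (chi : {rmorphism B -> C}) :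
  (forall x, chi x = 0 <-> I x) ->
  (forall x y, T x -> T y -> T (x + y)) -> (forall x y, T x -> T y -> T (x * y)) ->
  (forall x, T (x ^+ 2)) ->
  (forall x y, T x -> T y -> I (x + y) -> I x) ->
  ordcone [set x | exists t d, [/\ T t, chi d != 0 & x = chi t / chi d ^+ 2]].
Proof.
move=> chi0 TD TM TS Tconv.
have T1 : T 1 by rewrite -(expr1n _ 2).
split.
- by exists 1, 1; rewrite rmorph1 expr1n divr1 oner_eq0.
- move=> _ _ [t [d [Tt d0 ->]]] [t' [d' [Tt' d0' ->]]].
  exists (t * d' ^+ 2 + t' * d ^+ 2), (d * d'); split.
  + by apply: TD; apply: TM.
  + by rewrite rmorphM mulf_neq0.
  + by rewrite !(rmorphM, rmorphD, rmorphXn) /=; field; rewrite ?d0 ?d0' ?t0.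
- move=> _ _ [t [d [Tt d0 ->]]] [t' [d' [Tt' d0' ->]]].
  exists (t * t'), (d * d'); split; [exact: TM|by rewrite rmorphM mulf_neq0|].
  by rewrite !(rmorphM, rmorphD, rmorphXn) /=; field; rewrite ?d0 ?d0' ?t0.
- move=> _ _ [t [d [Tt d0 ->]]] [t' [d' [Tt' d0' ->]]].
  exists ((t * d' ^+ 2 - t' * d ^+ 2) ^+ 2), ((d * d') ^+ 2); split => //.
    by rewrite rmorphXn rmorphM expf_neq0 // mulf_neq0.
  by rewrite !(rmorphM, rmorphB, rmorphXn) /=; field; rewrite ?d0 ?d0' ?t0.
- move=> _ [t [d [Tt d0 ->]]]; have [t0|t0] := eqVneq (chi t) 0.
    exists (0 ^+ 2), 1; split => //; first by rewrite rmorph1 oner_eq0.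
    by rewrite t0 mul0r invr0 expr0n rmorph0 mul0r.
  exists (t * d ^+ 2), t; split=> //; first exact: TM.
  by rewrite rmorphM rmorphXn; field; rewrite ?d0 ?d0' ?t0.
- move=> [t [d [Tt d0 E]]].
  have td : I (d ^+ 2 + t).
    apply/chi0; rewrite rmorphD rmorphXn /=.
    have -> : chi t = - (chi d ^+ 2) by rewrite -[LHS](divfK (expf_neq0 2 d0)) -E mulN1r.
    by rewrite subrr.
  have /chi0 := Tconv _ _ (TS d) Tt td.
  by rewrite rmorphXn /= => /eqP; rewrite expf_eq0 /= (negPf d0).
Qed.

(** * Rational polynomials as terms of the elimination language *)

Section TermOfMpoly.
Variable k : nat.
Local Notation B := {mpoly rat[k]}.

Definition term_mon (m : 'X_{1..k}) : qe_rcf.term rat :=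
  foldr (fun (i : 'I_k) t => qe_rcf.Mul (qe_rcf.Exp (qe_rcf.Var rat (i : nat)) (m i)) t)
    (qe_rcf.NatConst rat 1) (index_enum 'I_k).

Definition term_mpoly (H : B) : qe_rcf.term rat :=
  foldr (fun m t => qe_rcf.Add (qe_rcf.Mul (qe_rcf.Const H@_m) (term_mon m)) t)
    (qe_rcf.NatConst rat 0) (msupp H).

Lemma tev_mpoly (F : rcfType) (e : seq F) H :
  tev e (term_mpoly H) = mmap (@ratr F) (fun i : 'I_k => e`_i) H.
Proof.
rewrite /term_mpoly /mmap; elim: (msupp H) => [|m s IH]; first by rewrite big_nil.
rewrite big_cons -IH; congr (_ * _ + _).
rewrite /term_mon /mmap1; elim: (index_enum _) => [|i r IHr]; first by rewrite big_nil.
by rewrite big_cons -IHr.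
Qed.

Lemma rmorph_mpoly_rat (A : unitRingType) (psi : {rmorphism B -> A}) (H : B) :
  psi H = mmap (@ratr A) (fun i => psi 'X_i) H.
Proof.
rewrite {1}[H]mpolyE rmorph_sum; apply: eq_bigr => m _.
rewrite -mul_mpolyC rmorphM.
have -> : psi (H@_m)%:MP = ratr H@_m by apply: (fmorph_eq_rat (psi \o @mpolyC k rat)).
congr (_ * _); rewrite mpolyXE_id rmorph_prod; apply: eq_bigr => i _.
by rewrite rmorphXn.
Qed.

Lemma mpoly_rat_encoding : exists (enc : B -> nat) (dec : nat -> option B), pcancel enc dec.
Proof.
pose f (p : B) : seq (rat * 'X_{1..k}) := [seq (p@_m, m) | m <- msupp p].
pose g (s : seq (rat * 'X_{1..k})) : B := \sum_(cm <- s) cm.1 *: 'X_[cm.2].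
have fK : cancel f g.
  by move=> p; rewrite /g /f big_map /= [RHS]mpolyE.
exists (fun p => pickle (f p)), (fun i => omap g (unpickle i)) => p.
by rewrite pickleK /= fK.
Qed.
End TermOfMpoly.

Lemma nth_set_seq (T : zmodType) (e x : seq T) N i :
  (foldr (fun ix e => set_nth 0 e ix.1 ix.2) e (zip (iota N (size x)) x))`_i =
  if (N <= i < N + size x)%N then x`_(i - N) else e`_i.
Proof.
elim: x N => [|y x IH] N /=; first by rewrite addn0 ltnNge andbN.
rewrite nth_set_nth /= IH addSnnS.
have [->|ne] := eqVneq i N; first by rewrite leqnn subnn /= addnS ltnS leq_addr.
have [lt|ge] := ltnP N i; last by have -> : (N <= i)%N = false by lia.
rewrite (ltnW lt) /=; case: ifP => // _.
by have -> : (i - N)%N = (i - N.+1).+1 by rewrite -subSn // subSS.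
Qed.

Section Nullstellensatz.
Variables (R : rcfType) (n : nat) (P u : {mpoly R[n]}).

(** Each coefficient is replaced by the variable that names its position in [c]. *)
Lemma mpoly_coef_lift (c : seq R) (p : {mpoly R[n]}) :
  (forall m, m \in msupp p -> p@_m \in c) ->
  exists H : {mpoly rat[size c + n]},
  mmap (@mpolyC n R \o @ratr R) (fun i => match fintype.split i with
     inl j => (c`_j)%:MP | inr j => 'X_j end) H = p.
Proof.
move=> hc.
pose phi : {rmorphism {mpoly rat[size c + n]} -> {mpoly R[n]}} :=
  mmap (@mpolyC n R \o @ratr R) (fun i => match fintype.split i with
     inl j => (c`_j)%:MP | inr j => 'X_j end).
pose v (m : 'X_{1..n}) : {mpoly rat[size c + n]} :=
  if insub (index p@_m c) is Some j then 'X_(lshift n j) else 0.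
exists (\sum_(m <- msupp p) v m * \prod_(i < n) 'X_(rshift (size c) i) ^+ m i).
rewrite -[LHS]/(phi _) rmorph_sum [RHS]mpolyE big_seq [RHS]big_seq; apply: eq_bigr => m mp.
rewrite rmorphM -mul_mpolyC; congr (_ * _).
  rewrite /v; case: insubP => [j jc jE|]; last by rewrite index_mem hc.
  by rewrite /phi /= mmapX mmap1U (unsplitK (inl j)) jE nth_index // hc.
rewrite mpolyXE_id rmorph_prod; apply: eq_bigr => i _.
by rewrite rmorphXn /phi /= mmapX mmap1U (unsplitK (inr i)).
Qed.

(* The [sos] of Defs, over an arbitrary real closed field. *)
Definition is_sos (p : {mpoly R[n]}) := exists s : seq {mpoly R[n]}, p = \sum_(q <- s) q ^+ 2.

Lemma is_sosD p q : is_sos p -> is_sos q -> is_sos (p + q).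
Proof. by move=> [s ->] [t ->]; exists (s ++ t); rewrite big_cat. Qed.

Lemma is_sosM p q : is_sos p -> is_sos q -> is_sos (p * q).
Proof.
move=> [s ->] [t ->]; exists [seq a * b | a <- s, b <- t].
rewrite big_allpairs_dep big_distrl; apply: eq_bigr => a _ /=.
by rewrite big_distrr; apply: eq_bigr => b _; rewrite exprMn.
Qed.

Lemma is_sos_sqr p : is_sos (p ^+ 2).
Proof. by exists [:: p]; rewrite big_seq1. Qed.

Lemma is_sosC (a : R) : 0 <= a -> is_sos a%:MP.
Proof.
by move=> a0; rewrite -(sqr_sqrtr a0) rmorphXn; apply: is_sos_sqr.
Qed.

Lemma is_sosX p m : is_sos (p ^+ (2 * m)).
Proof. by rewrite mulnC exprM; apply: is_sos_sqr. Qed.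

(** One polynomial [P] is enough to treat an ideal with finitely many generators, whose real zeros
    are those of the sum of their squares. *)
Theorem real_nullstellensatz :
  (forall x : 'I_n -> R, P.@[x] = 0 -> u.@[x] = 0) ->
  exists m (s c : {mpoly R[n]}), is_sos s /\ u ^+ (2 * m) + s = c * P.
Proof.
move=> hV; apply: contrapT => nex.
(* The first [N] variables of the countable ring stand for the coefficients of
   [P] and [u]; [phi] substitutes these. *)
pose c := [seq P@_m | m <- msupp P] ++ [seq u@_m | m <- msupp u].
pose N := size c.
pose phi : {rmorphism {mpoly rat[N + n]} -> {mpoly R[n]}} :=
  mmap (@mpolyC n R \o @ratr R) (fun i => match fintype.split i with
     inl j => (c`_j)%:MP | inr j => 'X_j end).
have [Ph PhE] : exists H, phi H = P.
  by apply: mpoly_coef_lift => m mP; rewrite mem_cat; apply/orP; left; apply/mapP; exists m.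
have [uh uhE] : exists H, phi H = u.
  by apply: mpoly_coef_lift => m mP; rewrite mem_cat; apply/orP; right; apply/mapP; exists m.
pose T := [set b | is_sos (phi b)].
(* The factor [w] puts the positive constants in [S], so that none of them
   vanishes in the residue field; this is what preserves their signs. *)
pose S := [set b | exists (w : R) m s, [/\ 0 < w, is_sos s & phi b = w%:MP * u ^+ (2 * m) + s]].
pose J := [set b | exists q : {mpoly R[n]}, phi b = q * P].
have TD x y : T x -> T y -> T (x + y) by rewrite /T /= rmorphD; apply: is_sosD.
have TM x y : T x -> T y -> T (x * y) by rewrite /T /= rmorphM; apply: is_sosM.
have TS x : T (x ^+ 2) by rewrite /T /= rmorphXn; apply: is_sos_sqr.
have ST : S `<=` T.
  move=> b [w [m [s [w0 ss E]]]]; rewrite /T /= E; apply: is_sosD => //.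
  by apply: is_sosM; [apply/is_sosC/ltW|exact: is_sosX].
have sos0 : is_sos 0 by exists [::]; rewrite big_nil.
have S1 : S 1.
  by exists 1, 0%N, 0; rewrite rmorph1 muln0 expr0 mpolyC1 mulr1 addr0; split.
have SM x y : S x -> S y -> S (x * y).
  move=> [w [m [s [w0 ss E]]]] [w' [m' [s' [w0' ss' E']]]].
  exists (w * w'), (m + m')%N, (w%:MP * u ^+ (2 * m) * s' + (phi y) * s); split.
  - exact: mulr_gt0.
  - have sw m1 w1 : 0 < w1 -> is_sos (w1%:MP * u ^+ (2 * m1)).
      by move=> w10; apply: is_sosM; [apply/is_sosC/ltW|exact: is_sosX].
    apply: is_sosD; apply: is_sosM => //; first exact: sw.
    by rewrite E'; apply: is_sosD => //; apply: sw.
  - by rewrite rmorphM E E' mpolyCM mulnDr exprD; ring.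
have SD x y : S x -> T y -> S (x + y).
  move=> [w [m [s [w0 ss E]]]] Ty; exists w, m, (s + phi y); split=> //.
    exact: is_sosD.
  by rewrite rmorphD E addrA.
have Jid : is_ideal J.
  split.
  - by exists 0; rewrite rmorph0 mul0r.
  - by move=> x y [q E] [q' E']; exists (q + q'); rewrite rmorphD E E' mulrDl.
  - by move=> x y [q E]; exists (phi x * q); rewrite rmorphM E mulrA.
have JS x : S x -> ~ J x.
  move=> [w [m [s [w0 ss E]]]] [q E']; apply: nex.
  exists m, ((w^-1)%:MP * s), ((w^-1)%:MP * q); split.
    by apply: is_sosM => //; apply: is_sosC; rewrite invr_ge0 ltW.
  by rewrite -mulrA -E' E mulrDr mulrA -mpolyCM mulVf ?gt_eqF // mul1r.
have [I [JI Iid IS Iprime Iconv]] := real_prime TD TM TS ST S1 SM SD Jid JS.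
pose I' : {pred {mpoly rat[N + n]}} := fun x => `[< I x >].
have I'P x : reflect (I x) (x \in I') by apply: asboolP.
have I'1 : idealr_closed I'.
  split; [by apply/I'P; exact: (ideal_zero Iid)|by apply/I'P; apply: IS|].
  by move=> a x y /I'P Ix /I'P Iy; apply/I'P; apply: (ideal_add Iid) => //; apply: (ideal_mull Iid).
have I'2 : prime_idealr_closed I'.
  by move=> x y /I'P/Iprime[] /I'P ->; rewrite ?orbT.
pose I1 : prime_idealr _ := HB.pack I' (isIdealr.Build _ _ I'1)
  (isPrimeIdealrClosed.Build _ _ I'2).
have [enc [dec encK]] := mpoly_rat_encoding (N + n).
have [C [chi chi0]] := @residue_closure _ I1 enc dec encK.
have {}chi0 x : chi x = 0 <-> I x by rewrite chi0; split=> /I'P.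
have oc := residue_cone chi0 TD TM TS Iconv.
have [M PM] := maxcone_exists oc.
have TC x : T x -> mcone M (chi x).
  move=> Tx; apply: PM; exists x, 1; split=> //; first by rewrite rmorph1 oner_neq0.
  by rewrite rmorph1 expr1n divr1.
(* Every [b] is a difference of two squares of the ring, and squares belong to [T]. *)
have dom b : chi b \in rdom M.
  apply/rdomP; pose r : {mpoly rat[N + n]} := (2^-1)%:MP.
  have e : b = (r * (b + 1)) ^+ 2 - (r * (b - 1)) ^+ 2.
    have -> : (r * (b + 1)) ^+ 2 - (r * (b - 1)) ^+ 2 = (r * 2) * (r * 2) * b by ring.
    by rewrite /r -mpolyC_nat -mpolyCM mulVf // mpolyC1 !mul1r.
  exists (chi ((r * (b + 1)) ^+ 2)), (chi ((r * (b - 1)) ^+ 2)).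
  by rewrite -rmorphB -e; split=> //; apply/TC/TS.
pose L := rclosure M; pose lb b : L := in_rclosure (dom b).
have lbB : zmod_morphism lb by move=> x y; apply: val_inj; rewrite /= !rmorphB.
have lbM : monoid_morphism lb.
  by split=> [|x y]; apply: val_inj; rewrite /= ?rmorph1 ?rmorphM.
pose lam : {rmorphism {mpoly rat[N + n]} -> L} :=
  HB.pack lb (GRing.isZmodMorphism.Build _ _ lb lbB)
    (GRing.isMonoidMorphism.Build _ _ lb lbM).
have lam0 b : lam b = 0 <-> I b.
  rewrite -chi0; split=> [E|E]; last by apply: val_inj; rewrite /= E.
  by have := congr1 val E.
have lamT b : T b -> 0 <= lam b by move=> Tb; apply/rclosure_ge0; apply: TC.
pose eL : seq L := mkseq (fun i => if insub i is Some j then lam 'X_(lshift n (j : 'I_N)) else 0) N.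
have eLE (j : 'I_N) : eL`_j = lam 'X_(lshift n j).
  by rewrite nth_mkseq // valK.
(* A term in the parameters is represented by one ring element, which [phi] sends to its real value
   and [lam] to its value in [L]. Signs in both fields are compared through this element. *)
have lift t : exists b, phi b = (tev c t)%:MP /\ lam b = tev eL t.
  elim: t => [i|q|m|t [b [E1 E2]] t' [b' [E1' E2']]|t [b [E1 E2]]|t [b [E1 E2]] m
    |t [b [E1 E2]] t' [b' [E1' E2']]|t [b [E1 E2]] m].
  - have [iN|Ni] := ltnP i N; last first.
      by exists 0; rewrite !rmorph0 /tev /= !nth_default ?size_mkseq // mpolyC0.
    exists 'X_(lshift n (Ordinal iN)); split; last by rewrite -eLE.
    by rewrite /phi /= mmapX mmap1U (unsplitK (inl (Ordinal iN))).
  - by exists q%:MP; rewrite /phi /= mmapC; split=> //; apply: (fmorph_eq_rat (lam \o @mpolyC _ rat)).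
  - by exists m%:R; rewrite !rmorph_nat.
  - by exists (b + b'); rewrite !rmorphD E1 E2 E1' E2'.
  - by exists (- b); rewrite !rmorphN E1 E2.
  - by exists (b *+ m); rewrite !rmorphMn E1 E2.
  - by exists (b * b'); rewrite !rmorphM E1 E2 E1' E2'.
  - by exists (b ^+ m); rewrite !rmorphXn E1 E2.
have pos t : 0 < tev c t -> 0 < tev eL t.
  move=> t0; have [b [E1 <-]] := lift t.
  have Sb : S b by exists (tev c t), 0%N, 0; rewrite muln0 expr0 mulr1 addr0; split.
  rewrite lt_neqAle eq_sym lamT ?andbT; last exact: ST.
  by apply/eqP => /lam0; apply: IS.
have sgn t : (0 < tev eL t) = (0 < tev c t).
  apply/idP/idP => [h|/pos //]; rewrite ltNge; apply/negP.
  rewrite le_eqVlt => /orP[/eqP t0|t0].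
    have [b [E1 E2]] := lift t.
    have : lam b = 0 by apply/lam0/JI; exists 0; rewrite E1 t0 mpolyC0 mul0r.
    by rewrite E2 => E; rewrite E ltxx in h.
  have := pos (qe_rcf.Opp t).
  have tevN (F : rcfType) (e : seq F) : tev e (qe_rcf.Opp t) = - tev e t by [].
  by rewrite !tevN !oppr_gt0 => /(_ t0); rewrite ltNge ltW.
pose xL : seq L := mkseq (fun i => if insub i is Some j then lam 'X_(rshift N (j : 'I_n)) else 0) n.
have xLE (j : 'I_n) : xL`_j = lam 'X_(rshift N j).
  by rewrite nth_mkseq // valK.
(* Clauses contain no disequalities: that [u] is nonzero is expressed by positivity of its
   square. *)
pose tP := term_mpoly Ph; pose tu := qe_rcf.Mul (term_mpoly uh) (term_mpoly uh).
pose D : seq (seq (qe_rcf.term rat) * seq (qe_rcf.term rat)) := [:: ([:: tP], [:: tu])].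
have DE (F : rcfType) (e : seq F) : dnf_holds e D = (tev e tP == 0) && (tev e (term_mpoly uh) != 0).
  rewrite /dnf_holds /= orbF /cl_holds /= !andbT; congr (_ && _).
  have -> : tev e tu = tev e (term_mpoly uh) ^+ 2 by rewrite expr2.
  by rewrite lt_neqAle sqr_ge0 andbT eq_sym sqrf_eq0.
have envL H : tev (foldr (fun ix e => set_nth 0 e ix.1 ix.2) eL (zip (iota N n) xL))
    (term_mpoly H) = lam H.
  rewrite tev_mpoly [RHS]rmorph_mpoly_rat; apply: eq_bigr => m _; congr (_ * _).
  apply: mmap1_eq => i; have := nth_set_seq eL xL N i.
  rewrite size_mkseq => ->; case: (fintype.splitP i) => j E.
    rewrite E leqNgt ltn_ord /= eLE; congr (lam 'X__).
    exact: val_inj.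
  rewrite E leq_addr ltn_add2l ltn_ord /= addKn xLE; congr (lam 'X__).
  exact: val_inj.
(* The images of the last [n] variables are a zero of [P] over [L], as [Ph] is in [J], and [u] does
   not vanish there, as [uh ^+ 2] is in [S]. The real point [y] obtained by transfer contradicts
   [hV]. *)
have [|||y sy] := @tarski_transfer L R eL c (iota N n) D xL.
- exact: sgn.
- by rewrite size_mkseq size_iota.
- rewrite DE !envL; apply/andP; split.
    by apply/eqP/lam0/JI; exists 1; rewrite PhE mul1r.
  apply/eqP => /lam0 Iu; apply: (IS (uh ^+ 2)); last by rewrite expr2; apply: (ideal_mull Iid).
  by exists 1, 1%N, 0; rewrite mpolyC1 mul1r addr0 rmorphXn uhE muln1; split.
have envR H : tev (foldr (fun ix e => set_nth 0 e ix.1 ix.2) c (zip (iota N n) y))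
    (term_mpoly H) = (phi H).@[fun i : 'I_n => y`_i].
  rewrite tev_mpoly -[RHS]/((meval _ \o phi) H) [RHS]rmorph_mpoly_rat.
  apply: eq_bigr => m _; congr (_ * _).
  apply: mmap1_eq => i; have := nth_set_seq c y N i.
  rewrite sy size_iota => ->; rewrite /phi /= mmapX mmap1U.
  case: (fintype.splitP i) => j E.
    by rewrite E leqNgt ltn_ord /= mevalC.
  by rewrite E leq_addr ltn_add2l ltn_ord /= addKn mevalXU.
rewrite DE !envR PhE uhE => /andP[/eqP /hV -> /negP]; apply.
exact: eqxx.
Qed.
End Nullstellensatz.

(** * Truncated moment functionals *)

Lemma peval_continuous (R : realType) (n : nat) (p : {mpoly R[n]}) :
  continuous (peval p : 'rV[R]_n -> R).
Proof.
have cD (a b : 'rV[R]_n -> R) : continuous a -> continuous b ->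
    continuous (fun x => a x + b x).
  by move=> ca cb x; exact: (cvgD (ca x) (cb x)).
have cM (a b : 'rV[R]_n -> R) : continuous a -> continuous b ->
    continuous (fun x => a x * b x).
  by move=> ca cb x; exact: (cvgM (ca x) (cb x)).
have cX (i : 'I_n) : continuous (fun x : 'rV[R]_n => x ord0 i).
  exact: coord_continuous.
have cC (c : R) : continuous (fun _ : 'rV[R]_n => c).
  exact: cst_continuous.
rewrite (_ : peval p = fun x => \sum_(m <- msupp p) p@_m * \prod_(i < n) x ord0 i ^+ m i); last first.
  by apply/funext => x; rewrite /peval mevalE.
elim: (msupp p) => [|m s IH].
  rewrite (_ : (fun x => _) = fun _ => 0) //.
  by apply/funext => x; rewrite big_nil.
rewrite (_ : (fun x => _) = fun x : 'rV[R]_n =>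
    p@_m * \prod_(i < n) x ord0 i ^+ m i + \sum_(m <- s) p@_m * \prod_(i < n) x ord0 i ^+ m i); last first.
  by apply/funext => x; rewrite big_cons.
apply: (@cD _ _) => //; apply: (cM (fun=> p@_m)) => //.
elim: (index_enum _) => [|i r IHr].
  rewrite (_ : (fun x => _) = fun _ => 1) //.
  by apply/funext => x; rewrite big_nil.
rewrite (_ : (fun x => _) = fun x : 'rV[R]_n =>
    x ord0 i ^+ m i * \prod_(i <- r) x ord0 i ^+ m i); last first.
  by apply/funext => x; rewrite big_cons.
apply: (@cM _ _) => //; elim: (m i) => [|k IHk].
  rewrite (_ : (fun x => _) = fun _ => 1) //.
rewrite (_ : (fun x => _) = fun x : 'rV[R]_n => x ord0 i * x ord0 i ^+ k); last first.
  by apply/funext => x; rewrite exprS.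
by apply: (@cM _ _).
Qed.

(** * Probability measures with finitely many atoms *)

Section Atomic.
Context (R : realType) (n : nat).
Local Notation V := 'rV[R]_n.
Local Notation T := (borelRn R n).

Lemma open_borelRn (A : set V) : open A -> measurable (A : set T).
Proof. by move=> oA; apply: sub_sigma_algebra. Qed.

Lemma continuous_borelRn (f : V -> R) : continuous f ->
  measurable_fun (setT : set T) (f : T -> R).
Proof.
move=> cf; apply: (measurability _ (RGenOInfty.measurableE R)).
move=> /= _ [_ [a ->] <-]; rewrite setTI; apply: open_borelRn.
by move/continuousP : cf; apply; apply: interval_open.
Qed.

Variables (s : seq V) (w : V -> R).
Hypotheses (w0 : forall x, x \in s -> 0 <= w x) (w1 : \sum_(x <- s) w x = 1).

(** The norm provides a nonnegative weight for every index, including those past the end of [s]; on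
    [s] it changes nothing. *)
Let ww (i : nat) : {nonneg R} := NngNum (normr_ge0 (w s`_i)).
Let m (i : nat) : {measure set T -> \bar R} := mscale (ww i) (\d_(s`_i : T)).
Let mm : {measure set T -> \bar R} := msum m (size s).

Let wwE i : (i < size s)%N -> (ww i)%:num = w s`_i.
Proof. by move=> h /=; rewrite ger0_norm // w0 // mem_nth. Qed.

Let mmE (A : set T) : mm A = (\sum_(x <- s) w x * \1_A x)%:E.
Proof.
rewrite /mm /= /msum -sumEFin (big_nth 0) big_mkord; apply: eq_bigr => i _.
by rewrite /m /= /mscale wwE // EFinM diracE indicE.
Qed.

Let mmT : mm setT = 1%E.
Proof.
rewrite mmE; congr EFin; rewrite -w1; apply: eq_bigr => x _.
by rewrite indicT mulr1.
Qed.

Let mint (f : T -> \bar R) : measurable_fun (setT : set T) f -> (forall x, 0 <= f x)%E ->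
  (\int[mm]_x f x = \sum_(x <- s) (w x)%:E * f x)%E.
Proof.
move=> mf f0; rewrite /mm ge0_integral_measure_sum // (big_nth 0) big_mkord.
apply: eq_bigr => i _; rewrite /m ge0_integral_mscale // wwE //.
by rewrite integral_dirac // diracT mul1e.
Qed.

Lemma atomic_probability : exists mu : probability T R,
  (forall A : set T, mu A = (\sum_(x <- s) w x * \1_A x)%:E) /\
  forall f : V -> R, continuous f ->
    mu.-integrable setT (EFin \o f) /\
    (\int[mu]_x (f x)%:E = (\sum_(x <- s) w x * f x)%:E)%E.
Proof.
pose mu : probability T R := HB.pack (msum m (size s))
   (Measure_isProbability.Build _ _ _ (msum m (size s)) mmT).
exists mu; split=> [A|f cf]; first exact: mmE.
have mf : measurable_fun (setT : set T) (EFin \o f : T -> \bar R).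
  by apply/measurable_EFinP; apply: continuous_borelRn.
have muint (g : T -> \bar R) : (\int[mu]_x g x = \int[mm]_x g x)%E by [].
split.
  apply/integrableP; split=> //; rewrite muint mint //; last first.
    exact: measurableT_comp.
  rewrite (eq_bigr (fun x => (w x * `|f x|)%:E)); last first.
    by move=> x _; rewrite /= EFinM.
  by rewrite sumEFin ltry.
rewrite integralE !muint !mint //; last 2 first.
- exact: measurable_funeneg.
- exact: measurable_funepos.
rewrite [X in (X - _)%E](eq_bigr (fun x => (w x * Num.max (f x) 0)%:E)); last first.
  by move=> x _; rewrite EFinM funeposE /= -EFin_max.
rewrite [X in (_ - X)%E](eq_bigr (fun x => (w x * Num.max (- f x) 0)%:E)); last first.
  by move=> x _; rewrite EFinM funenegE /= -EFin_max.
rewrite !sumEFin -EFinB -sumrB; congr EFin; apply: eq_bigr => x _.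
rewrite -mulrBr; congr (_ * _).
by case: (lerP (f x) 0) => h; case: (lerP (- f x) 0) => h'; lra.
Qed.
End Atomic.

(** * Signs of functionals in large order *)

Section Functionals.
Variables (R : realType) (n : nat).
Local Notation P := {mpoly R[n]}.
Implicit Types (p q : P) (L : P -> R).

Lemma deg_le_size p t : (msize p <= t)%N -> deg_le p t.
Proof. by move=> h; apply: leq_trans h _. Qed.

Lemma deg_leD p q t : deg_le p t -> deg_le q t -> deg_le (p + q) t.
Proof.
by move=> hp hq; apply: leq_trans (msizeD_le _ _) _; rewrite geq_max hp hq.
Qed.

Lemma deg_leZ (a : R) p t : deg_le p t -> deg_le (a *: p) t.
Proof. by move=> hp; apply: leq_trans (msizeZ_le _ _) hp. Qed.

Lemma deg_le0 t : deg_le (0 : P) t.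
Proof. by rewrite /deg_le msize0. Qed.

Section Fixed.
Variables (t : nat) (L : P -> R).
Hypothesis hL : functional_on t L.

Lemma functional0 : L 0 = 0.
Proof.
have := hL 1 (deg_le0 t) (deg_le0 t); rewrite scaler0 addr0 mul1r.
by move=> /eqP; rewrite -subr_eq0 opprD addrA subrr sub0r oppr_eq0 => /eqP.
Qed.

Lemma functionalZ a p : deg_le p t -> L (a *: p) = a * L p.
Proof.
by move=> hp; have := hL a hp (deg_le0 t); rewrite addr0 functional0 addr0.
Qed.

Lemma functionalD p q : deg_le p t -> deg_le q t -> L (p + q) = L p + L q.
Proof. by move=> hp hq; have := hL 1 hp hq; rewrite scale1r mul1r. Qed.

Lemma functional_sum (I : eqType) (r : seq I) (a : I -> R) (p : I -> P) :
  (forall i, i \in r -> deg_le (p i) t) ->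
  deg_le (\sum_(i <- r) a i *: p i) t /\
  L (\sum_(i <- r) a i *: p i) = \sum_(i <- r) a i * L (p i).
Proof.
elim: r => [|i r IH] h; first by rewrite !big_nil functional0; split=> //; apply: deg_le0.
rewrite !big_cons; have hi : deg_le (p i) t by apply: h; rewrite mem_head.
have [hr E] : deg_le (\sum_(i <- r) a i *: p i) t /\
    L (\sum_(i <- r) a i *: p i) = \sum_(i <- r) a i * L (p i).
  by apply: IH => j jr; apply: h; rewrite inE jr orbT.
split; first by apply: deg_leD => //; apply: deg_leZ.
by rewrite hL // E.
Qed.
End Fixed.

Variable G : seq P.

Lemma quadmod_sos s t : is_sos s -> deg_le s t -> quadmod G t s.
Proof.
move=> ss hs; exists s, (fun=> 0); split=> //.
  move=> i; split; last by left.
  by exists [::]; rewrite big_nil.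
by rewrite big1 ?addr0 // => i _; rewrite mul0r.
Qed.

Lemma quadmod_sosM s g t : is_sos s -> g \in G -> (msize s + msize g <= t.+2)%N ->
  quadmod G t (s * g).
Proof.
move=> ss gG hsg; have iG : (index g G < size G)%N by rewrite index_mem.
pose i0 := Ordinal iG.
have sos0 : sos (0 : P) by exists [::]; rewrite big_nil.
exists 0, (fun i => if i == i0 then s else 0); split=> //; first exact: deg_le0.
  move=> i; case: eqP => [->|_]; last by split=> //; left.
  by split=> //; right; right; rewrite nth_index.
rewrite add0r (bigD1 i0) //= eqxx nth_index // big1 ?addr0 // => i /negPf ->.
by rewrite mul0r.
Qed.

(** The threshold [D] depends on [p] but not on [L]; this uniformity is the source of [d(k)]. *)
Definition eventually_nonneg p := exists D, forall d L, (D <= d)%N ->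
  Lcone G (2 * d) L -> 0 <= L p.
Definition eventually_zero p := exists D, forall d L, (D <= d)%N ->
  Lcone G (2 * d) L -> L p = 0.

Lemma eventually_nonnegD p q : eventually_nonneg p -> eventually_nonneg q ->
  eventually_nonneg (p + q).
Proof.
move=> [D1 h1] [D2 h2]; exists (maxn (maxn D1 D2) (maxn (msize p) (msize q))) => d L.
rewrite !geq_max -andbA => /and4P[d1 d2 dp dq] hL.
rewrite (functionalD hL.1); try by apply: deg_le_size; lia.
by apply: addr_ge0; [apply: h1 hL|apply: h2 hL].
Qed.

Lemma eventually_nonneg_sos s : is_sos s -> eventually_nonneg s.
Proof.
move=> ss; exists (msize s) => d L hd hL; apply: hL.2.
by apply: quadmod_sos => //; apply: deg_le_size; apply: leq_trans hd _; lia.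
Qed.

Lemma eventually_nonneg_sosM s g : is_sos s -> g \in G -> eventually_nonneg (s * g).
Proof.
move=> ss gG; exists (msize s + msize g)%N => d L hd hL; apply: hL.2.
by apply: quadmod_sosM => //; lia.
Qed.

Lemma eventually_zeroP p : eventually_nonneg p -> eventually_nonneg (- p) ->
  eventually_zero p.
Proof.
move=> [D1 h1] [D2 h2]; exists (maxn (maxn D1 D2) (msize p)) => d L.
rewrite !geq_max -andbA => /and3P[d1 d2 dp] hL.
apply/eqP; rewrite eq_le (h1 d L) // andbT.
have := h2 d L d2 hL; rewrite -scaleN1r (functionalZ hL.1) ?mulN1r ?oppr_ge0 //.
by apply: deg_le_size; lia.
Qed.

(** Cauchy-Schwarz: when [L (q ^+ 2) = 0], applying [L] to the square of [(a / 2) q + 1] gives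
    [0 <= a * L q + L 1] for all [a]. If [L q] were nonzero, a suitable [a] would make the
    right-hand side [- 1]. *)
Lemma eventually_zero_sqr q : eventually_zero (q ^+ 2) -> eventually_zero q.
Proof.
move=> [D hD]; exists (maxn D (maxn 2 (2 * msize q))) => d L.
rewrite !geq_max => /and3P[d1 d2 dq] hL.
have dq2 : deg_le (q ^+ 2) (2 * d).
  apply: deg_le_size; rewrite expr2; apply: leq_trans (msizeM_le _ _) _; lia.
have dq1 : deg_le q (2 * d) by apply: deg_le_size; lia.
have d11 : deg_le (1 : P) (2 * d) by apply: deg_le_size; rewrite msize1; lia.
have q20 : L (q ^+ 2) = 0 by exact: (hD d L d1 hL).
have key a : 0 <= a * L q + L 1.
  have -> : a * L q + L 1 = L ((((a / 2)%:MP : P) * q + 1) ^+ 2).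
    have -> : (((a / 2)%:MP : P) * q + 1) ^+ 2 =
        (a / 2) ^+ 2 *: q ^+ 2 + (a *: q + 1).
      rewrite -!mul_mpolyC sqrrD1 exprMn rmorphXn -addrA -mulrnAl -rmorphMn /=.
      by rewrite -[a / 2 *+ 2]mulr_natr divfK.
    rewrite (functionalD hL.1) ?(functionalZ hL.1) ?q20 ?mulr0 ?add0r //.
    - by rewrite (functionalD hL.1) ?(functionalZ hL.1) //; apply: deg_leZ.
    - exact: deg_leZ.
    - by apply: deg_leD => //; apply: deg_leZ.
  apply: hL.2; apply: quadmod_sos; first exact: is_sos_sqr.
  rewrite /deg_le expr2; apply: leq_trans (msizeM_le _ _) _.
  have : (msize ((a / 2)%:MP * q + 1) <= maxn (msize q) 1)%N.
    apply: leq_trans (msizeD_le _ _) _; rewrite msize1 mul_mpolyC.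
    by rewrite geq_max leq_maxr andbT leq_max msizeZ_le.
  lia.
apply/eqP/negPn/negP => q0.
have := key (- (L 1 + 1) / L q); rewrite divfK //; lra.
Qed.

Lemma eventually_zero_exp2 q b : eventually_zero (q ^+ (2 ^ b)) -> eventually_zero q.
Proof.
elim: b => [|b IH]; first by rewrite expn0 expr1.
by rewrite expnSr exprM => /eventually_zero_sqr.
Qed.
End Functionals.

(** * Polynomials vanishing on the real variety *)

Section Variety.
Variables (R : realType) (n : nat) (g h' : seq {mpoly R[n]}).
Local Notation P := {mpoly R[n]}.
Local Notation G := (pm_family g h').
Local Notation J := (ideal_gen [set q | q \in h']).

Lemma mem_pm_family (q : P) : q \in h' -> q \in G /\ - q \in G.
Proof.
move=> qh; rewrite !mem_cat; split; apply/orP; right; apply/flatten_mapP;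
  by exists q => //; rewrite !inE eqxx ?orbT.
Qed.

(** Any cofactor [c] is the difference of the squares of [(c + 1) / 2] and [(c - 1) / 2], and both
    [q] and [- q] are in the family. *)
Lemma eventually_nonneg_ideal (p : P) : J p -> eventually_nonneg G p.
Proof.
move=> [m [c [q [hq ->]]]].
elim/big_ind: _ => [|x y|i _]; first last.
- have [q1 q2] := mem_pm_family (hq i).
  have r : c i * q i = (2^-1 *: (c i + 1)) ^+ 2 * q i + (2^-1 *: (c i - 1)) ^+ 2 * - q i.
    rewrite mulrN -mulrBl; congr (_ * _).
    rewrite -!mul_mpolyC !exprMn -mulrBr.
    have -> : (c i + 1) ^+ 2 - (c i - 1) ^+ 2 = (4%:R)%:MP * c i.
      by rewrite mpolyC_nat; ring.
    rewrite mulrA -rmorphXn -mpolyCM (_ : _ * _ = 1 :> R) ?mpolyC1 ?mul1r //.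
    by field.
  rewrite r; apply: eventually_nonnegD; apply: eventually_nonneg_sosM => //;
    exact: is_sos_sqr.
- exact: eventually_nonnegD.
- by apply: eventually_nonneg_sos; exists [::]; rewrite big_nil.
Qed.

Lemma ideal_gen_mul (A : set P) (c p : P) : ideal_gen A p -> ideal_gen A (c * p).
Proof.
move=> [m [a [q [hq ->]]]]; exists m, (fun i => c * a i), q; split=> //.
by rewrite big_distrr; apply: eq_bigr => i _; rewrite /= mulrA.
Qed.

Lemma ideal_gen_sqsum : J (\sum_(q <- h') q ^+ 2).
Proof.
exists (size h'), (fun i => h'`_i), (fun i => h'`_i); split.
  by move=> i; apply: mem_nth.
by rewrite (big_nth 0) big_mkord; apply: eq_bigr => i _; rewrite expr2.
Qed.

Lemma eventually_zero_variety (q : P) :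
  (forall x, real_variety J x -> peval q x = 0) -> eventually_zero G q.
Proof.
move=> hq; pose Q := \sum_(p <- h') p ^+ 2.
have [|m [s [c [ss E]]]] := @real_nullstellensatz R n Q q.
  move=> x Qx; pose y : 'rV[R]_n := \row_i x i.
  have ev p : peval p y = p.@[x].
    by apply: meval_eq => i; rewrite mxE.
  rewrite -ev; apply: hq => p [k [a [r [hr ->]]]].
  rewrite ev rmorph_sum big1 // => i _; rewrite rmorphM /=.
  suff -> : (r i).@[x] = 0 by rewrite mulr0.
  have : \sum_(p <- h') (p.@[x]) ^+ 2 = 0.
    by rewrite -[RHS]Qx /Q rmorph_sum; apply: eq_bigr => t _; rewrite rmorphXn.
  move/eqP; rewrite psumr_eq0; last by move=> t _; apply: sqr_ge0.
  by move/allP => /(_ _ (hr i)) /=; rewrite sqrf_eq0 => /eqP.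
(* The exponent is raised from [2 * m] to a power of two, as needed for the repeated use of
   Cauchy-Schwarz. The gap [r] is even, so [q ^+ r * s] is still a sum of squares. *)
pose b := (2 * m).+1; pose r := (2 ^ b - 2 * m)%N.
have r2 : r = (2 * (2 ^ (2 * m) - m))%N by rewrite /r /b expnS mulnBr.
have mb : (2 * m <= 2 ^ b)%N.
  by apply: leq_trans (ltnW (ltn_expl b (ltnSn 1))); rewrite /b leqnSn.
apply: (@eventually_zero_exp2 _ _ _ _ b).
have Er : q ^+ (2 ^ b) = (q ^+ r * c) * Q - q ^+ r * s.
  rewrite -mulrA -E mulrDr addrK -exprD; congr (_ ^+ _).
  by rewrite /r subnK.
apply: eventually_zeroP.
  apply: eventually_nonneg_sos; rewrite /b expnS; exact: is_sosX.
rewrite Er opprB; apply: eventually_nonnegD.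
  by apply: eventually_nonneg_sos; apply: is_sosM => //; rewrite r2; apply: is_sosX.
rewrite -mulNr; apply: eventually_nonneg_ideal; apply: ideal_gen_mul.
exact: ideal_gen_sqsum.
Qed.
End Variety.

(** * Lagrange interpolation at finitely many points *)

Section Interpolation.
Variables (R : realType) (n : nat).
Local Notation P := {mpoly R[n]}.
Implicit Types (p q : P) (x y : 'rV[R]_n) (s : seq 'rV[R]_n).

Lemma pevalD p q x : peval (p + q) x = peval p x + peval q x.
Proof. by rewrite /peval mevalD. Qed.
Lemma pevalB p q x : peval (p - q) x = peval p x - peval q x.
Proof. by rewrite /peval mevalB. Qed.
Lemma pevalM p q x : peval (p * q) x = peval p x * peval q x.
Proof. by rewrite /peval mevalM. Qed.
Lemma pevalZ a p x : peval (a *: p) x = a * peval p x.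
Proof. by rewrite /peval mevalZ. Qed.
Lemma peval1 x : peval 1 x = 1.
Proof. by rewrite /peval meval1. Qed.
Lemma peval_sum (I : Type) (r : seq I) (Q : pred I) (F : I -> P) x :
  peval (\sum_(i <- r | Q i) F i) x = \sum_(i <- r | Q i) peval (F i) x.
Proof. by rewrite /peval raddf_sum. Qed.
Lemma peval_prod (I : Type) (r : seq I) (Q : pred I) (F : I -> P) x :
  peval (\prod_(i <- r | Q i) F i) x = \prod_(i <- r | Q i) peval (F i) x.
Proof. by rewrite /peval rmorph_prod. Qed.

Definition sqdist y : P := \sum_(i < n) ('X_i - (y ord0 i)%:MP) ^+ 2.

Lemma peval_sqdist y x : peval (sqdist y) x = \sum_(i < n) (x ord0 i - y ord0 i) ^+ 2.
Proof.
rewrite peval_sum; apply: eq_bigr => i _.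
by rewrite /peval rmorphXn /= mevalB mevalXU mevalC.
Qed.

Lemma peval_sqdist_eq0 y x : (peval (sqdist y) x == 0) = (x == y).
Proof.
rewrite peval_sqdist psumr_eq0; last by move=> i _; apply: sqr_ge0.
apply/allP/eqP => [h|-> i _]; last by rewrite subrr expr0n /= eqxx.
apply/rowP => i; have := h i (mem_index_enum _).
by rewrite /= sqrf_eq0 subr_eq0 => /eqP.
Qed.

(** Over the reals, the squared distance to a point is a polynomial vanishing only there, so it
    replaces the linear factors of the univariate formula. *)
Definition lagrange s x : P :=
  let q := \prod_(y <- s | y != x) sqdist y in (peval q x)^-1 *: q.

Lemma peval_lagrange s x y : y \in s -> peval (lagrange s x) y = (y == x)%:R.
Proof.
move=> ys; rewrite /lagrange pevalZ; have [->|yx] := eqVneq y x.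
  rewrite mulVf // peval_prod prodf_seq_neq0; apply/allP => z _.
  by apply/implyP => zx; rewrite peval_sqdist_eq0 eq_sym.
rewrite [X in _ * X]peval_prod; apply/eqP; rewrite mulf_eq0; apply/orP; right.
by rewrite prodf_seq_eq0; apply/hasP; exists y => //; rewrite yx peval_sqdist_eq0 eqxx.
Qed.

Lemma peval_interpolation s p y : uniq s -> y \in s ->
  peval (\sum_(x <- s) peval p x *: lagrange s x) y = peval p y.
Proof.
move=> us ys; rewrite peval_sum (bigD1_seq y) //= pevalZ peval_lagrange // eqxx mulr1.
rewrite big1 ?addr0 // => x xy; rewrite pevalZ peval_lagrange // eq_sym.
by rewrite (negPf xy) mulr0.
Qed.
End Interpolation.

Lemma eventually_zero_fin (R : realType) (n : nat) (G : seq {mpoly R[n]})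
    (I : finType) (q : I -> {mpoly R[n]}) :
  (forall i, eventually_zero G (q i)) ->
  exists D, forall d L, (D <= d)%N -> Lcone G (2 * d) L -> forall i, L (q i) = 0.
Proof.
move=> /choice[D hD]; exists (\max_i D i) => d L hd hL i.
by apply: hD hL; apply: leq_trans hd; apply: leq_bigmax.
Qed.

(** * Functionals of large order as atomic measures *)

Section Exactness.
Variables (R : realType) (n : nat) (g h' : seq {mpoly R[n]}).
Local Notation P := {mpoly R[n]}.
Local Notation G := (pm_family g h').
Local Notation J := (ideal_gen [set q | q \in h']).
Hypothesis fin : finite_set (real_variety J).

Lemma moment_atomic (k : nat) : exists D, forall d L, (D <= d)%N ->
  Lcone1 G (2 * d) L ->
  exists (s : seq 'rV[R]_n) (w : 'rV[R]_n -> R), [/\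
    forall x, x \in s -> real_variety J x,
    forall x, x \in s -> 0 <= w x,
    forall x, x \in s -> ~ semialg g x -> w x = 0 &
    forall p, deg_le p k -> L p = \sum_(x <- s) w x * peval p x].
Proof.
have [s0 sE] : exists s0 : seq 'rV[R]_n, real_variety J = [set` s0].
  exact/finite_seqP.
pose s := undup s0; have us : uniq s := undup_uniq _.
have sV x : (x \in s) <-> real_variety J x by rewrite mem_undup sE.
pose e := lagrange s.
(* Killing these expresses [L] on monomials of degree at most [k], hence on all polynomials of such
   degree, by the numbers [L (e x)]. *)
pose qm (m : 'X_{1..n < k.+1}) : P := 'X_[m] - \sum_(x <- s) peval 'X_[m] x *: e x.
have [D1 hD1] : exists D, forall d L, (D <= d)%N -> Lcone G (2 * d) L ->
    forall m, L (qm m) = 0.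
  apply: eventually_zero_fin => m; apply: eventually_zero_variety => x /sV xs.
  by rewrite pevalB peval_interpolation // subrr.
(* This gives [L (e x) = L (e x ^+ 2)], so the weights are nonnegative. *)
pose q1 (i : 'I_(size s)) := e s`_i - (e s`_i) ^+ 2.
have [D2 hD2] : exists D, forall d L, (D <= d)%N -> Lcone G (2 * d) L ->
    forall i, L (q1 i) = 0.
  apply: eventually_zero_fin => i; apply: eventually_zero_variety => x /sV xs.
  by rewrite pevalB expr2 pevalM peval_lagrange // -natrM mulnb andbb subrr.
(* This gives [L (e x ^+ 2 * q) = peval q x * L (e x)] for [q] in [g]. The left-hand side is
   nonnegative, so the weight vanishes where [q] is negative. *)
pose q2 (ij : 'I_(size s) * 'I_(size g)) :=
  (e s`_ij.1) ^+ 2 * g`_ij.2 - peval g`_ij.2 s`_ij.1 *: e s`_ij.1.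
have [D3 hD3] : exists D, forall d L, (D <= d)%N -> Lcone G (2 * d) L ->
    forall i, L (q2 i) = 0.
  apply: eventually_zero_fin => -[i j]; apply: eventually_zero_variety => x /sV xs.
  rewrite pevalB pevalZ pevalM expr2 pevalM peval_lagrange // -natrM mulnb andbb.
  by case: eqP => [->|_] /=; rewrite ?mul1r ?mulr1 ?mul0r ?mulr0 subrr.
pose me := \max_(x <- s) msize (e x).
pose mg := \max_(q <- g) msize q.
(* The last two bounds keep the monomials of degree at most [k] and all products [e x ^+ 2 * q]
   within degree [2 * d], where [L] is linear. *)
exists (maxn (maxn D1 (maxn D2 D3)) (maxn k.+1 (2 * me + mg + 3))%N) => d L.
rewrite !geq_max -!andbA => /and5P[d1 d2 d3 dk dme] [hL L1].
have hF := hL.1.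
have me_ge x : x \in s -> (msize (e x) <= me)%N.
  by move=> xs; apply: leq_bigmax_seq.
have mg_ge q : q \in g -> (msize q <= mg)%N.
  by move=> xs; apply: leq_bigmax_seq.
have dege x : x \in s -> deg_le (e x) (2 * d).
  by move=> /me_ge h; apply: deg_le_size; lia.
have mse2 x : x \in s -> (msize (e x ^+ 2) <= (2 * me).+1)%N.
  move=> /me_ge h; rewrite expr2; apply: leq_trans (msizeM_le _ _) _; lia.
have dege2 x : x \in s -> deg_le (e x ^+ 2) (2 * d).
  by move=> /mse2 h; apply: deg_le_size; lia.
have LB p q : deg_le p (2 * d) -> deg_le q (2 * d) -> L (p - q) = L p - L q.
  move=> hp hq; rewrite -scaleN1r (functionalD hF) ?(functionalZ hF) ?mulN1r //.
  exact: deg_leZ.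
have w0 x : x \in s -> 0 <= L (e x).
  move=> xs; have xi : (index x s < size s)%N by rewrite index_mem.
  have := hD2 d L d2 hL (Ordinal xi); rewrite /q1 /= nth_index // => /eqP.
  rewrite (LB _ _ (dege x xs) (dege2 x xs)); rewrite subr_eq0 => /eqP ->; apply: hL.2.
  by apply: quadmod_sos; [exact: is_sos_sqr|exact: dege2].
exists s, (fun x => L (e x)); split.
- by move=> x /sV.
- exact: w0.
- move=> x xs nS; apply/eqP; rewrite eq_le w0 // andbT.
  have [q [qg qx]] : exists q, q \in g /\ peval q x < 0.
    apply: contrapT => nq; apply: nS => q qg; rewrite leNgt; apply/negP => qx.
    by apply: nq; exists q.
  have xi : (index x s < size s)%N by rewrite index_mem.
  have qi : (index q g < size g)%N by rewrite index_mem.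
  have dq : deg_le (e x ^+ 2 * q) (2 * d).
    apply: deg_le_size; apply: leq_trans (msizeM_le _ _) _.
    by have := mse2 x xs; have := mg_ge q qg; lia.
  have := hD3 d L d3 hL (Ordinal xi, Ordinal qi); rewrite /q2 /= !nth_index //.
  move/eqP; rewrite (LB _ _ dq (deg_leZ _ (dege x xs))) (functionalZ hF _ (dege x xs)).
  rewrite subr_eq0 => /eqP E.
  rewrite -(nmulr_rge0 _ qx) -E; apply: hL.2; apply: quadmod_sosM.
  + exact: is_sos_sqr.
  + by rewrite mem_cat qg.
  + by apply: leq_trans (leq_add (mse2 x xs) (mg_ge q qg)) _; lia.
- move=> p hp.
  have dX (m : 'X_{1..n < k.+1}) : deg_le ('X_[m] : P) (2 * d).
    rewrite /deg_le msizeX; have := bmdeg m; lia.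
  have LX (m : 'X_{1..n < k.+1}) : L 'X_[m] = \sum_(x <- s) peval 'X_[m] x * L (e x).
    have [dS LS] := @functional_sum _ _ _ _ hF _ s (fun x => peval 'X_[m] x) e dege.
    by have /eqP := hD1 d L d1 hL m; rewrite LB // subr_eq0 LS => /eqP.
  have pE := mpolywE hp.
  have [_ Lp] := @functional_sum _ _ _ _ hF _ (index_enum _) (fun m : 'X_{1..n < k.+1} => p@_m)
    (fun m => 'X_[m]) (fun m _ => dX m).
  rewrite {1}pE Lp (eq_bigr (fun m : 'X_{1..n < k.+1} => \sum_(x <- s) p@_m * (peval 'X_[m] x * L (e x)))); last first.
    by move=> m _; rewrite LX big_distrr.
  rewrite exchange_big; apply: eq_bigr => x _ /=.
  rewrite [in RHS]pE peval_sum big_distrr; apply: eq_bigr => m _ /=.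
  by rewrite pevalZ [RHS]mulrC mulrA.
Qed.

Lemma moment_measure (k : nat) : exists D, forall d L, (D <= d)%N ->
  Lcone1 G (2 * d) L -> moment_restr (semialg g `&` real_variety J) k L.
Proof.
have [D hD] := moment_atomic k; exists D => d L hd hL.
have [s [w [sV w0 wS Lw]]] := hD d L hd hL.
have w1 : \sum_(x <- s) w x = 1.
  rewrite -[RHS]hL.2 Lw; last by rewrite /deg_le msize1.
  by apply: eq_bigr => x _; rewrite peval1 mulr1.
have [mu [muE muI]] := atomic_probability w0 w1.
exists mu; split.
- move=> x xmu; apply: contrapT => nT.
  (* The set [F] is finite, hence closed, and carries all the mass, so its complement is an open
     null set and contains no point of the support. *)
  pose F := [set y | y \in s /\ semialg g y].
  have cF : closed F.
    have [+ _] := @accessible_finite_set_closed 'rV[R]_n; apply.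
      exact/hausdorff_accessible/norm_hausdorff.
    by apply: (@sub_finite_set _ _ [set` s]) => [y []|] //; apply: finite_seq.
  have Fx : (~` F) x by move=> [xs xg]; apply: nT; split=> //; apply: sV.
  have := xmu _ (closed_openC cF) Fx; rewrite muE big_seq big1 ?ltxx // => y ys.
  have [yg|/(wS y ys) ->] := pselect (semialg g y); last by rewrite mul0r.
  by rewrite indicE memNset ?mulr0 //=; apply; split.
- by move=> p; have [] := muI _ (@peval_continuous _ _ p).
- move=> p hp; have [_ ->] := muI _ (@peval_continuous _ _ p).
  by rewrite Lw.
Qed.
End Exactness.

(** * Critical points *)

Section Gradient.
Variables (R : realType) (n : nat).
Local Notation P := {mpoly R[n]}.
Implicit Types (p q : P) (x y : 'rV[R]_n).

Lemma mderivXU (i j : 'I_n) : ('X_i : P)^`M(j) = (i == j)%:R%:MP.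
Proof.
rewrite mderivX mnm1E; have [->|ij] := eqVneq i j; last by rewrite scale0r mpolyC0.
rewrite scale1r (_ : (U_(j) - U_(j))%MM = 0%MM) ?mpolyX0 //.
by apply/mnmP => k; rewrite mnmBE mnm0E subnn.
Qed.

(** Restriction to the line through [x] parallel to the axis [j], which reduces partial derivatives
    to derivatives in one variable. *)
Definition restr_line x (j : 'I_n) : {rmorphism P -> {poly R}} :=
  mmap (@polyC R) (fun i => (x ord0 i)%:P + (i == j)%:R *: 'X).

Lemma horner_restr_line x j p t :
  (restr_line x j p).[t] = peval p (\row_i (x ord0 i + (i == j)%:R * t)).
Proof.
rewrite /peval mevalE /= /mmap horner_sum; apply: eq_bigr => m _.
rewrite hornerM hornerC; congr (_ * _); rewrite horner_prod; apply: eq_bigr => i _.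
by rewrite horner_exp hornerD hornerC hornerZ hornerX mxE.
Qed.

Lemma horner_restr_line0 x j p : (restr_line x j p).[0] = peval p x.
Proof.
by rewrite horner_restr_line; apply: meval_eq => i; rewrite mxE mulr0 addr0.
Qed.

(** Both sides are linear in [p] and obey the Leibniz rule at [x], so it is enough to compare them
    on the variables. *)
Lemma deriv_restr_line x j p : ((restr_line x j p)^`()).[0] = peval p^`M(j) x.
Proof.
pose D p := ((restr_line x j p)^`()).[0] = peval p^`M(j) x.
have DM a b : D a -> D b -> D (a * b).
  rewrite /D => Da Db; rewrite mderivM rmorphM derivM hornerD !hornerM Da Db.
  by rewrite !horner_restr_line0 pevalD !pevalM.
have D1 : D 1.
  by rewrite /D rmorph1 derivC horner0 -mpolyC1 mderivC /peval meval0.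
have DX i : D 'X_i.
  rewrite /D /= mmapX mmap1U derivD derivC add0r derivZ derivX hornerZ hornerC mulr1.
  by rewrite mderivXU /peval mevalC.
elim/mpolyind: p => [|c m p _ _ IH]; first by rewrite rmorph0 deriv0 mderiv0 horner0 /peval meval0.
rewrite rmorphD derivD hornerD mderivD pevalD IH; congr (_ + _).
rewrite -mul_mpolyC mderiv_mulC rmorphM /= mmapC derivM derivC mul0r add0r hornerM hornerC.
rewrite mul_mpolyC pevalZ; congr (_ * _); rewrite -/(D _) mpolyXE_id.
elim/big_ind: _ => // i _; elim: (m i) => [|k IHk]; first by rewrite expr0.
by rewrite exprS; apply: DM.
Qed.

Lemma mderiv_local_min x (j : 'I_n) p (d : R) : 0 < d ->
  (forall y, (forall i, `|y ord0 i - x ord0 i| < d) -> peval p x <= peval p y) ->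
  peval p^`M(j) x = 0.
Proof.
move=> d0 hmin; rewrite -deriv_restr_line.
have h : is_derive (0 : R) 1 (horner (restr_line x j p)) 0.
  apply: (@derive1_at_min _ _ (- d) d).
  - by lra.
  - by move=> t _; apply: derivable_horner.
  - by rewrite in_itv /= oppr_lt0 d0.
  - move=> t; rewrite in_itv /= => /andP[t1 t2].
    rewrite horner_restr_line0 horner_restr_line; apply: hmin => i.
    rewrite mxE addrAC subrr add0r; case: eqP => _; rewrite ?mul1r ?mul0r ?normr0 //.
    by rewrite ltr_norml t1.
have h' := is_derive_poly (restr_line x j p) 0.
exact: etrans (esym (@derive_val _ _ _ _ _ _ _ h')) (@derive_val _ _ _ _ _ _ _ h).
Qed.

Lemma peval_min p (A : set 'rV[R]_n) : A !=set0 -> compact A ->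
  exists2 x, A x & forall y, A y -> peval p x <= peval p y.
Proof.
move=> A0 cA.
have [|x] := EVT_min_rV A0 cA (f := peval p).
  by apply: continuous_subspaceT; apply: peval_continuous.
rewrite inE => Ax hx; exists x => // y Ay; apply: hx; rewrite inE //.
Qed.
End Gradient.

(** * Quadratic penalty near a local minimizer *)

Section Penalty.
Variables (R : realType) (n : nat) (f : {mpoly R[n]}) (cs : seq {mpoly R[n]})
  (x0 : 'rV[R]_n) (r : R).
Local Notation P := {mpoly R[n]}.
Hypothesis r0 : 0 < r.
Let K : set 'rV[R]_n := [set x | forall i, `[x0 ord0 i - r, x0 ord0 i + r]%classic (x ord0 i)].
Hypothesis c0 : forall c, c \in cs -> peval c x0 = 0.
Hypothesis fmin : forall x, K x -> (forall c, c \in cs -> peval c x = 0) ->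
  peval f x0 <= peval f x.

Let csq : P := \sum_(c <- cs) c ^+ 2.
(** The term [sqdist x0] makes [x0] the only minimizer under the constraints on [K], which draws the
    minimizers of [pen N] towards [x0] as [N] grows. *)
Let pen (N : R) : P := f + sqdist x0 + N *: csq.

Let cK : compact K.
Proof.
apply: (@rV_compact _ _ (fun i => `[x0 ord0 i - r, x0 ord0 i + r]%classic)) => i.
exact: segment_compact.
Qed.

Let Kx0 : K x0.
Proof. by move=> i /=; rewrite in_itv /= gerBl lerDl ltW. Qed.

Let csqE x : peval csq x = \sum_(c <- cs) peval c x ^+ 2.
Proof.
by rewrite peval_sum; apply: eq_bigr => c _; rewrite expr2 pevalM expr2.
Qed.

Let csq_ge0 x : 0 <= peval csq x.
Proof. by rewrite csqE; apply: sumr_ge0 => c _; apply: sqr_ge0. Qed.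

Let csq_eq0 x : peval csq x = 0 -> forall c, c \in cs -> peval c x = 0.
Proof.
move/eqP; rewrite csqE psumr_eq0; last by move=> c _; apply: sqr_ge0.
by move=> /allP h c /h /=; rewrite sqrf_eq0 => /eqP.
Qed.

Let csq_x0 : peval csq x0 = 0.
Proof.
by rewrite csqE big_seq big1 // => c /c0 ->; rewrite expr0n.
Qed.

Let sqdist_x0 : peval (sqdist x0) x0 = 0.
Proof. by apply/eqP; rewrite peval_sqdist_eq0. Qed.

Let pen_x0 N : peval (pen N) x0 = peval f x0.
Proof. by rewrite /pen !pevalD pevalZ csq_x0 sqdist_x0 mulr0 !addr0. Qed.

Let closed_ge p (a : R) : closed [set x : 'rV[R]_n | a <= peval p x].
Proof.
by move/continuous_closedP : (@peval_continuous _ _ p) => /(_ _ (@closed_ge R a)).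
Qed.

Let closed_le p (a : R) : closed [set x : 'rV[R]_n | peval p x <= a].
Proof.
by move/continuous_closedP : (@peval_continuous _ _ p) => /(_ _ (@closed_le R a)).
Qed.

(** On the compact set [Z] of points away from [x0] where [G] is at most [f(x0)], the constraints
    cannot all vanish, so [csq] has a positive minimum there. Outside [Z] the inequality needs only
    [N >= 0], apart from the case of empty [Z], where [N = 0] will do. *)
Lemma penalty_large (e : R) : 0 < e -> exists N, forall x, K x ->
  e <= peval (sqdist x0) x -> peval f x0 < peval (pen N) x.
Proof.
move=> e0; pose G : P := f + sqdist x0.
pose Z := K `&` ([set x | e <= peval (sqdist x0) x] `&` [set x | peval G x <= peval f x0]).
have cZ : compact Z.
  apply: (subclosed_compact _ cK); last by move=> x [].
  apply: closedI; last by apply: closedI.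
  by apply: compact_closed => //; apply: norm_hausdorff.
have penE N x : peval (pen N) x = peval G x + N * peval csq x.
  by rewrite /pen /G pevalD pevalZ.
have [Z0|Z0] := pselect (Z !=set0); last first.
  exists 0 => x Kx ex; rewrite penE mul0r addr0 ltNge; apply/negP => Gx.
  by apply: Z0; exists x; split.
have [z [Kz [ez Gz]] zmin] := peval_min csq Z0 cZ.
have dz : 0 < peval csq z.
  rewrite lt_neqAle csq_ge0 andbT eq_sym; apply/eqP => /csq_eq0 h.
  have := fmin Kz h; move: Gz ez; rewrite /= /G pevalD; lra.
have [y Ky ymin] := peval_min G (ex_intro _ x0 Kx0) cK.
pose B := peval f x0 - peval G y.
have B0 : 0 <= B.
  have := ymin _ Kx0; rewrite /B [peval G x0]pevalD sqdist_x0; lra.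
(* On [K], the value of [G] is at least [f(x0) - B], and on [Z] this [N] makes the penalty at least
   [B + 1]. *)
exists ((B + 1) / peval csq z) => x Kx ex; rewrite penE.
have N0 : 0 <= (B + 1) / peval csq z by rewrite divr_ge0 ?ltW //; lra.
have [Gx|Gx] := lerP (peval G x) (peval f x0); last first.
  by apply: (lt_le_trans Gx); rewrite lerDl mulr_ge0.
have Zx : Z x by split.
have h1 := ler_wpM2l N0 (zmin _ Zx).
rewrite divfK ?gt_eqF // in h1.
have BE : B = peval f x0 - peval G y by [].
have := ymin _ Kx; move: (_ * peval csq x) h1 => a h1; lra.
Qed.

(** At points far from [x0] the penalized function exceeds its value at [x0], so its minimizer on
    [K] is close to [x0], thus interior to [K], and the gradient vanishes there. *)
Lemma penalty_critical (e : R) : 0 < e -> exists (N : R) (x : 'rV[R]_n),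
  (forall i, `|x ord0 i - x0 ord0 i| < e) /\
  forall j : 'I_n, peval f^`M(j) x + 2 * (x ord0 j - x0 ord0 j)
    + N * \sum_(c <- cs) 2 * peval c x * peval c^`M(j) x = 0.
Proof.
move=> e0; pose d := Num.min e r; have d0 : 0 < d by rewrite lt_min e0.
have [N hN] := penalty_large (mulr_gt0 d0 d0).
have [x Kx xmin] := peval_min (pen N) (ex_intro _ x0 Kx0) cK.
exists N, x.
have xd i : `|x ord0 i - x0 ord0 i| < d.
  rewrite ltNge; apply/negP => hi.
  have : d * d <= peval (sqdist x0) x.
    rewrite peval_sqdist (bigD1 i) //=; apply: ler_wpDr.
      by apply: sumr_ge0 => k _; apply: sqr_ge0.
    by rewrite -real_normK ?num_real // expr2; apply: ler_pM => //; apply: ltW.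
  by move=> /(hN _ Kx); rewrite ltNge -(pen_x0 N) xmin.
split=> [i|j]; first by apply: lt_le_trans (xd i) _; rewrite ge_min lexx.
(* The largest coordinate distance [mx] leaves a margin [d - mx] around [x] inside the box [K]. *)
have [mx m1 md] : exists2 mx, forall i, `|x ord0 i - x0 ord0 i| <= mx & mx < d.
  exists (\big[Num.max/0]_i `|x ord0 i - x0 ord0 i|); last by apply/bigmax_ltP; split.
  by move=> i; apply: (le_bigmax _ (fun k => `|x ord0 k - x0 ord0 k|)).
have dd0 : 0 < d - mx by rewrite subr_gt0.
have := @mderiv_local_min _ _ x j (pen N) (d - mx) dd0.
have -> : peval (pen N)^`M(j) x = peval f^`M(j) x + 2 * (x ord0 j - x0 ord0 j)
    + N * \sum_(c <- cs) 2 * peval c x * peval c^`M(j) x.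
  rewrite /pen !mderivD mderivZ !pevalD pevalZ; congr (_ + _ + _ * _).
    rewrite /sqdist linear_sum peval_sum (bigD1 j) //= big1 ?addr0 => [|i ij].
      rewrite expr2 mderivM mderivB mderivC subr0 mderivXU eqxx mpolyC1 mul1r mulr1.
      by rewrite pevalD pevalB /peval mevalXU mevalC; ring.
    rewrite expr2 mderivM mderivB mderivC subr0 mderivXU (negPf ij) mpolyC0.
    by rewrite mul0r mulr0 addr0 /peval meval0.
  rewrite /csq linear_sum peval_sum; apply: eq_bigr => c _.
  by rewrite /= expr2 mderivM pevalD !pevalM; ring.
apply=> y hy; apply: xmin => i /=; rewrite in_itv /=.
have h : `|y ord0 i - x0 ord0 i| < d.
  rewrite -(subrK (x ord0 i) (y ord0 i)) -addrA.
  apply: le_lt_trans (ler_normD _ _) _.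
  by have := hy i; have := m1 i; move: (`|_|) (`|_|) => a b; lra.
have dr : d <= r by rewrite ge_min lexx orbT.
by move: h; rewrite ltr_norml => /andP[h1 h2]; apply/andP; split; lra.
Qed.
End Penalty.

(** * Fritz John conditions and the polar ideal *)

Section FritzJohn.
Variables (R : realType) (n : nat).
Local Notation P := {mpoly R[n]}.

Lemma peval_eq0_approx (p : P) (x0 : 'rV[R]_n) :
  (forall e : R, 0 < e -> exists2 x : 'rV[R]_n,
     forall i, `|x ord0 i - x0 ord0 i| < e & peval p x = 0) ->
  peval p x0 = 0.
Proof.
move=> h; apply/eqP/negPn/negP => p0.
have : \forall x \near x0, peval p x != 0.
  apply: (@peval_continuous _ _ p x0 [set y | y != 0]).
  by apply: open_nbhs_nbhs; split=> //; apply: open_neq.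
move=> /nbhs_ballP[e /= e0 he]; have [x xe px] := h e e0.
have /he : ball x0 e x.
  split=> // i j; rewrite ord1 /ball /= distrC; exact: xe.
by rewrite /= px eqxx.
Qed.

(** The multipliers may be unbounded as the penalized minimizers approach [x0]. They are eliminated
    first, which leaves a polynomial equation that passes to the limit by continuity. *)
Lemma fritz_john_minor (f : P) (cs : seq P) (x0 : 'rV[R]_n) (r : R) (l : nat)
    (s : 'I_l -> 'I_(size (f :: cs))) (c : 'I_l -> 'I_n) :
  0 < r ->
  (forall p, p \in cs -> peval p x0 = 0) ->
  (forall x : 'rV[R]_n, (forall i, `[x0 ord0 i - r, x0 ord0 i + r]%classic (x ord0 i)) ->
     (forall p, p \in cs -> peval p x = 0) -> peval f x0 <= peval f x) ->
  l = size (f :: cs) -> injective s ->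
  peval (\det (mxsub s c (Defs.jacobian (f :: cs)))) x0 = 0.
Proof.
move=> r0 c0 fmin El sinj; subst l.
set M := mxsub _ _ _.
(* At a minimizer [x] of the penalized problem the multipliers [lam], with
   [lam 0 = 1], satisfy lam * Jac(x) = - 2 (x - x0); multiplying by the adjugate
   of [M] shows that [E] vanishes at [x], while E(x0) = det M(x0). *)
have [i0 si0] : exists i0, s i0 = ord0 :> 'I_(size cs).+1.
  by have /codomP[i0 ->] := inj_card_onto sinj (leqnn _) (ord0 : 'I_(size cs).+1); exists i0.
pose E : P := \det M + \sum_j (2 *: ('X_(c j) - (x0 ord0 (c j))%:MP)) * (\adj M) j i0.
have E0 : peval E x0 = peval (\det M) x0.
  rewrite pevalD [X in _ + X]peval_sum [X in _ + X]big1 ?addr0 // => j _.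
  by rewrite pevalM pevalZ pevalB /peval mevalXU mevalC subrr mulr0 mul0r.
rewrite -E0; apply: peval_eq0_approx => e e0.
have [N [x [xe crit]]] := penalty_critical r0 c0 fmin e0.
exists x => //.
pose ev : {rmorphism P -> R} := meval (fun i => x ord0 i).
pose Mx := map_mx ev M.
pose lam (k : nat) : R := (1 :: [seq N * (2 * peval p x) | p <- cs])`_k.
pose v : 'rV[R]_(size (f :: cs)) := \row_i lam (s i).
have vM j : (v *m Mx) ord0 j = - (2 * (x ord0 (c j) - x0 ord0 (c j))).
  rewrite mxE.
  under eq_bigr => i _ do rewrite !mxE.
  rewrite -(reindex_inj sinj (P := predT)
     (F := fun k : 'I_(size (f :: cs)) => lam k * ev ((f :: cs)`_k)^`M(c j))) /=.
  rewrite big_ord_recl /= mul1r.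
  have := crit (c j); rewrite mulr_sumr (big_nth 0) big_mkord => Ec.
  apply/eqP; rewrite -addr_eq0 -[X in _ == X]Ec; apply/eqP.
  rewrite addrAC; congr (_ + _); apply: eq_bigr => k _.
  rewrite /lam /= add0n (nth_map 0) ?ltn_ord //.
  by rewrite -!mulrA.
have : ((v *m Mx) *m \adj Mx) ord0 i0 = \det Mx.
  by rewrite -mulmxA mul_mx_adj mul_mx_scalar !mxE si0 /lam /= mulr1.
rewrite mxE => Ed.
rewrite /E pevalD [X in _ + X]peval_sum; apply/eqP; rewrite addrC addr_eq0; apply/eqP.
have -> : peval (\det M) x = \det Mx by rewrite det_map_mx.
rewrite -Ed -sumrN; apply: eq_bigr => j _.
have -> : (\adj Mx) j i0 = peval (\adj M j i0) x by rewrite -map_mx_adj [LHS]mxE.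
rewrite vM mulNr opprK pevalM pevalZ pevalB.
by rewrite /peval mevalXU mevalC.
Qed.

Section VanishingAt.
Variable x : 'rV[R]_n.
Local Notation vanish I := (forall p : P, I p -> peval p x = 0).

Lemma ideal_gen_vanish (A : set P) : vanish A -> vanish (ideal_gen A).
Proof.
move=> hA p [m [c [q [hq ->]]]]; rewrite peval_sum big1 // => i _.
by rewrite pevalM (hA _ (hq i)) mulr0.
Qed.

Lemma ideal_prod_vanish (Is : seq (set P)) k : (k < size Is)%N ->
  vanish (nth set0 Is k) -> vanish (ideal_prod Is).
Proof.
elim: Is k => // I Is IH [|k] /= kI hI.
  by apply: ideal_gen_vanish => _ [a [b [Ia _ ->]]]; rewrite pevalM (hI a Ia) mul0r.
apply: ideal_gen_vanish => _ [a [b [_ Ib ->]]].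
by rewrite pevalM (IH k kI hI b Ib) mulr0.
Qed.
End VanishingAt.

(** The product of ideals vanishes at [x0] as soon as one factor does, and the factor of the set [A]
    of active inequalities is used. The inactive ones stay positive near [x0], so [x0] is a local
    minimizer under the equations [cs] and the minors vanish by [fritz_john_minor]. *)
Lemma minimizer_polar (f : P) (g h : seq P) (x0 : 'rV[R]_n) :
  semialg (pm_family g h) x0 ->
  (forall y, semialg (pm_family g h) y -> peval f x0 <= peval f y) ->
  real_variety (polar_ideal f g h) x0.
Proof.
move=> Sx0 fmin.
have h0 q : q \in h -> peval q x0 = 0.
  move=> /mem_pm_family -/(_ g)[/Sx0 q1 /Sx0].
  rewrite -scaleN1r pevalZ mulN1r oppr_ge0 => q2.
  by apply/eqP; rewrite eq_le q2.
pose A : {set 'I_(size g)} := finset (fun a : 'I_(size g) => peval g`_a x0 == 0).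
pose cs := h ++ [seq g`_a | a : 'I_(size g) <- enum A].
have cs0 p : p \in cs -> peval p x0 = 0.
  rewrite mem_cat => /orP[/h0 //|/mapP[a]].
  by rewrite mem_enum inE => /eqP ? ->.
have [r r0 hr] : exists2 r : R, 0 < r & forall y : 'rV[R]_n,
    (forall i, `|y ord0 i - x0 ord0 i| <= r) -> forall a : 'I_(size g), a \notin A ->
    0 < peval g`_a y.
  have near_a (a : 'I_(size g)) : a \notin A -> \forall y \near x0, 0 < peval g`_a y.
    rewrite inE => ga; apply: (@peval_continuous _ _ g`_a x0 [set t | 0 < t]).
    apply: open_nbhs_nbhs; split; first exact: open_gt.
    by rewrite /= lt_neqAle eq_sym ga Sx0 // mem_cat mem_nth.
  have : \forall y \near x0, forall a : 'I_(size g), a \notin A -> 0 < peval g`_a y.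
    apply: (@filter_forall _ _ (fun a y => a \notin A -> 0 < peval g`_a y) _ (nbhs_filter x0)) => a.
    have [aA|aA] := boolP (a \in A).
      by apply: nearW.
    by apply: filterS (near_a a aA).
  move=> /nbhs_ballP[e /= e0 he]; exists (e / 2); first by rewrite divr_gt0.
  move=> y hy; apply: he; split=> // i j; rewrite ord1 /ball /= distrC.
  by apply: le_lt_trans (hy j) _; rewrite ltr_pdivrMr // ltr_pMr // ltr1n.
have floc (x : 'rV[R]_n) : (forall i, `[x0 ord0 i - r, x0 ord0 i + r]%classic (x ord0 i)) ->
    (forall p, p \in cs -> peval p x = 0) -> peval f x0 <= peval f x.
  move=> xr xc; apply: fmin => q; rewrite mem_cat => /orP[qg|].
    have ai : (index q g < size g)%N by rewrite index_mem.
    have qE : q = g`_(Ordinal ai) by rewrite nth_index.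
    have [aA|aA] := boolP (Ordinal ai \in A).
      rewrite xc // mem_cat; apply/orP; right; rewrite qE.
      by apply/mapP; exists (Ordinal ai) => //; rewrite mem_enum.
    rewrite qE; apply/ltW/hr => // i.
    have := xr i; rewrite /= in_itv /= => /andP[h1 h2].
    by rewrite ler_distl h1.
  move=> /flatten_mapP[p ph]; rewrite !inE => /orP[] /eqP ->.
    by rewrite xc // mem_cat ph.
  by rewrite -scaleN1r pevalZ xc ?mulr0 // mem_cat ph.
apply: ideal_gen_vanish => p [|].
  by apply: ideal_gen_vanish => q /= /h0.
set F := fun A : {set 'I_(size g)} => _.
have iA : (index A (enum [set: {set 'I_(size g)}]) < size [seq F A | A <- enum [set: {set 'I_(size g)}]])%N.
  by rewrite size_map index_mem mem_enum inE.
apply: (ideal_prod_vanish iA); rewrite (nth_map finset.set0); last by rewrite -(size_map F).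
rewrite nth_index ?mem_enum ?inE //.
apply: ideal_gen_vanish => q [|].
  apply: ideal_gen_vanish => _ [a aA ->].
  by move: aA; rewrite inE => /eqP.
apply: ideal_gen_vanish => _ [s [c [sinj _ ->]]].
apply: (@fritz_john_minor f cs x0 r _ s c r0 cs0 floc _ sinj).
by rewrite /= size_cat size_map -cardE.
Qed.
End FritzJohn.

(** * Exactness of the relaxation *)

Lemma peval_Lcone1 (R : realType) (n : nat) (G : seq {mpoly R[n]}) (t : nat)
    (x : 'rV[R]_n) : semialg G x -> Lcone1 G t (fun p => peval p x).
Proof.
have sos_ge0 (p : {mpoly R[n]}) : sos p -> 0 <= peval p x.
  move=> [s ->]; rewrite peval_sum sumr_ge0 // => q _.
  by rewrite expr2 pevalM -expr2 sqr_ge0.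
move=> Gx; split; last exact: peval1.
split=> [a p q _ _|_ [s0 [s [ss0 _ hs ->]]]]; first by rewrite pevalD pevalZ.
rewrite pevalD peval_sum; apply: addr_ge0; first exact: sos_ge0.
apply: sumr_ge0 => i _; rewrite pevalM; apply: mulr_ge0.
  by apply: sos_ge0; case: (hs i).
by apply: Gx; apply: mem_nth.
Qed.

Lemma pm_family_semialg (R : realType) (n : nat) (g h : seq {mpoly R[n]}) (x : 'rV[R]_n) :
  semialg (pm_family g h) x <->
  semialg g x /\ forall q, q \in h -> peval q x = 0.
Proof.
split=> [Sx|[gx hx] q].
  split=> [q qg|q /(mem_pm_family g)[/Sx q1 /Sx]]; first by apply: Sx; rewrite mem_cat qg.
  rewrite -scaleN1r pevalZ mulN1r oppr_ge0 => q2.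
  by apply/eqP; rewrite eq_le q2.
rewrite mem_cat => /orP[/gx //|/flatten_mapP[p /hx p0]].
rewrite !inE => /orP[] /eqP ->; first by rewrite p0.
by rewrite -scaleN1r pevalZ p0 mulr0.
Qed.

Theorem mainTheorem9 (R : realType) (n : nat) (f : {mpoly R[n]})
    (g h h' : seq {mpoly R[n]}) (fstar : R) :
  (exists2 x, semialg (pm_family g h) x & peval f x = fstar) ->
  (forall y, semialg (pm_family g h) y -> fstar <= peval f y) ->
  polar_ideal f g h = ideal_gen [set q | q \in (h')] ->
  finite_set (real_variety (polar_ideal f g h)) ->
  (exists d0 : nat, forall d : nat, (d0 <= d)%N ->
      fMoM f (pm_family g h') d = fstar%:E) /\
  (exists k0 : nat, forall k : nat, (k0 <= k)%N ->
    exists dk : nat, forall d : nat, (dk <= d)%N ->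
      forall sigma : {mpoly R[n]} -> R,
        Lcone1 (pm_family g h') (2 * d) sigma -> sigma f = fstar ->
        moment_restr (semialg (pm_family g h) `&` real_variety (polar_ideal f g h)) k sigma
        /\ moment_restr (semialg (pm_family g h)) k sigma).
Proof.
move=> [x0 Sx0 fx0] fmin JE fin.
(* As [J] contains [h], a point of its variety where all of [g] is nonnegative lies in [S]. *)
have Jh q : q \in h -> polar_ideal f g h q.
  move=> qh; exists 1%N, (fun=> 1), (fun=> q); split=> [_|]; last by rewrite big_ord1 mul1r.
  left; exists 1%N, (fun=> 1), (fun=> q); split=> [_ //|].
  by rewrite big_ord1 mul1r.
have Vsub x : semialg g x -> real_variety (polar_ideal f g h) x -> semialg (pm_family g h) x.
  by move=> gx Vx; apply/pm_family_semialg; split=> // q /Jh; apply: Vx.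
have Vx0 : real_variety (polar_ideal f g h) x0.
  by apply: minimizer_polar => // y /fmin; rewrite fx0.
have Gx0 : semialg (pm_family g h') x0.
  apply/pm_family_semialg; split; first by case/pm_family_semialg : Sx0.
  move=> q qh; apply: Vx0; rewrite JE; exists 1%N, (fun=> 1), (fun=> q).
  by split=> [_ //|]; rewrite big_ord1 mul1r.
rewrite JE in fin Vsub *.
split.
  have [D hD] := moment_atomic g fin (msize f); exists D => d dD.
  apply/eqP; rewrite eq_le; apply/andP; split.
    (* Evaluation at the minimizer [x0], which lies on the variety of [J], is feasible and attains
       [fstar]. *)
    apply: ereal_inf_lbound; exists (fun p => peval p x0); last by rewrite fx0.
    exact: peval_Lcone1.
  apply: le_ereal_inf_tmp => _ [L hL <-]; rewrite lee_fin.
  have [s [w [sV w0 wS Lw]]] := hD d L dD hL.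
  have w1 : \sum_(x <- s) w x = 1.
    rewrite -[RHS]hL.2 Lw; last by rewrite /deg_le msize1.
    by apply: eq_bigr => x _; rewrite peval1 mulr1.
  rewrite Lw; last exact: leqnSn.
  (* The value [L f] is a weighted mean of values of [f] at points of [S], all at least [fstar];
     points outside [S] have weight zero. *)
  rewrite -[leLHS]mul1r -w1 big_distrl /= big_seq [leRHS]big_seq; apply: ler_sum => x xs.
  have [gx|/(wS x xs) ->] := pselect (semialg g x); last by rewrite !mul0r.
  by apply: ler_wpM2l; [exact: w0|apply: fmin; apply: Vsub => //; apply: sV].
exists 0%N => k _; have [D hD] := moment_measure g fin k; exists D => d dD L hL _.
have [mu [supp int val]] := hD d L dD hL.
by split; exists mu; split=> // x /supp[gx Vx]; [split|]; rewrite //; apply: Vsub.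
Qed.
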